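(* Let $k$ be a field, let $(A,B,\varepsilon)$ be a triple over $k$, let $n\ge 1$, and let $M$ be an $A$-bimodule which is $B$-symmetric. Let $M_n(A)$ be the algebra of $n\times n$ matrices over $A$, let $I_n(B)=B\cdot I_n$ be the algebra of scalar $n\times n$ matrices with entries in $B$, and let $\varepsilon_*:I_n(B)\to M_n(A)$ be the map sending the scalar matrix with diagonal entry $\alpha$ to the scalar matrix with diagonal entry $\varepsilon(\alpha)$. Then $(A,B,\varepsilon)$ and $(M_n(A),I_n(B),\varepsilon_* )$ are Morita equivalent as triples. In particular, $$\mathrm{H}_\bullet((A,B,\varepsilon);M)\cong \mathrm{H}_\bullet((M_n(A),I_n(B),\varepsilon_* );M_n(M)).$$
   Context: Fix a field $k$; $\otimes=\otimes_k$, and all $k$-algebras are unital. Triples. A triple $(A,B,\varepsilon)$ over $k$ consists of an associative $k$-algebra $A$, a commutative $k$-algebra $B$, and a morphism of $k$-algebras $\varepsilon:B\to A$ with $\varepsilon(B)\subseteq \mathcal{Z}(A)$ (the center of $A$). An $A$-bimodule $M$ is $B$-symmetric if $m\varepsilon(\alpha)=\varepsilon(\alpha)m$ for all $m\in M$, $\alpha\in B$. One has $\varepsilon_*(I_n(B))\subseteq\mathcal{Z}(M_n(A))$, so $(M_n(A),I_n(B),\varepsilon_* )$ is a triple. $M_n(M)$ denotes the $n\times n$ matrices with entries in $M$, an $M_n(A)$-bimodule by matrix multiplication. Morita equivalence of triples. Two triples $(A,B,\varepsilon)$ and $(A',B',\varepsilon')$ are Morita equivalent as triples if: (i) there exist an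 $A$-$A'$-bimodule $P$ and an $A'$-$A$-bimodule $Q$ with an isomorphism of $A$-bimodules $f:P\otimes_{A'}Q\to A$ and an isomorphism of $A'$-bimodules $g:Q\otimes_A P\to A'$; (ii) there is an isomorphism of $k$-algebras $\eta:B\to B'$; (iii) $\varepsilon(\alpha)p=p\,\varepsilon'(\eta(\alpha))$ and $q\,\varepsilon(\alpha)=\varepsilon'(\eta(\alpha))q$ for all $p\in P$, $q\in Q$, $\alpha\in B$. Secondary Hochschild homology. For a triple $(A,B,\varepsilon)$ and a $B$-symmetric $A$-bimodule $M$, $\mathrm{H}_\bullet((A,B,\varepsilon);M)$ is the homology of the chain complex with $C_n((A,B,\varepsilon);M)=M\otimes A^{\otimes n}\otimes B^{\otimes n(n-1)/2}$ for $n\ge 0$ (here $n$ is the homological degree). An elementary tensor is written $m\otimes T$, where $T$ is an $n\times n$ array with diagonal entries $a_1,\dots,a_n\in A$, entries $b_{p,q}\in B$ for $1\le p<q\le n$, and $1$ below the diagonal. The differential $\partial_n^\varepsilon:C_n\to C_{n-1}$ is $\partial_n^\varepsilon=\sum_{i=0}^n(-1)^i\delta_i$ where: - $\delta_0(m\otimes T)=m a_1\varepsilon(b_{1,2}b_{1,3}\cdots b_{1,n})\otimes T_0$, with $T_0$ obtained from $T$ by deleting the first row and column; - for $1\le i\le n-1$, $\delta_i(m\otimes T)=m\otimes T_i$, where $T_i$ is the $(n-1)\times(n-1)$ array with diagonal entries $a_1,\dots,a_{i-1},\,a_i\varepsilon(b_{i,i+1})a_{i+1},\,a_{i+2},\dots,a_n$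 and entries $b'_{p,q}$ ($p<q$) given by $b'_{p,q}=b_{p,q}$ if $q<i$; $b'_{p,i}=b_{p,i}b_{p,i+1}$ if $p<i$; $b'_{p,q}=b_{p,q+1}$ if $p<i<q$; $b'_{i,q}=b_{i,q+1}b_{i+1,q+1}$ if $q>i$; $b'_{p,q}=b_{p+1,q+1}$ if $p>i$; - $\delta_n(m\otimes T)=a_n\varepsilon(b_{1,n}b_{2,n}\cdots b_{n-1,n})m\otimes T_n$, with $T_n$ obtained from $T$ by deleting the last row and column. In particular $\partial_1^\varepsilon(m\otimes a)=ma-am$. *)

(* Defs.v *)
From HB Require Import structures.
From mathcomp Require Import freeg.
From mathcomp Require Import all_boot all_algebra.
From mathcomp Require Import boolp zify.

Set Implicit Arguments.
Unset Strict Implicit.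
Unset Printing Implicit Defensive.

Import GRing.Theory.
Local Open Scope ring_scope.
Local Open Scope quotient_scope.

Section Span.
Variables (k : fieldType) (V : lmodType k) (S : V -> Prop).

Inductive in_lspan : V -> Prop :=
| lspan_zero : in_lspan 0
| lspan_cons c x y : S x -> in_lspan y -> in_lspan (c *: x + y).

Definition lspan : {pred V} := fun v => `[< in_lspan v >].

Lemma lspanP v : reflect (in_lspan v) (v \in lspan).
Proof. exact: asboolP. Qed.

Lemma lspan_gen x : S x -> x \in lspan.
Proof.
move=> Sx; apply/lspanP; rewrite -[x]scale1r -[1 *: x]addr0.
by apply: lspan_cons => //; apply: lspan_zero.
Qed.

Lemma lspan_closed : subsemimod_closed lspan.
Proof.
split; first split.
- by apply/lspanP; apply: lspan_zero.
- move=> u v /lspanP + /lspanP hv; elim=> [|c x y Sx _ IH].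
    by rewrite add0r; apply/lspanP.
  by apply/lspanP; rewrite -addrA; apply: lspan_cons Sx _; apply/lspanP.
- move=> a u /lspanP; elim=> [|c x y Sx _ IH].
    by rewrite scaler0; apply/lspanP; apply: lspan_zero.
  apply/lspanP; rewrite scalerDr scalerA.
  by apply: lspan_cons Sx _; apply/lspanP.
Qed.

HB.instance Definition _ := GRing.isSubmodClosed.Build k V lspan lspan_closed.

End Span.

Section Quotient.
Variables (k : fieldType) (V : lmodType k) (S : V -> Prop).

(* V / <S>, the quotient by the k-submodule generated by S *)
Definition quotmod : Type := Quotient.quot (lspan S).
HB.instance Definition _ := GRing.Zmodule.on quotmod.

Definition qproj (v : V) : quotmod := \pi_(Quotient.quot (lspan S)) v.
Definition qrepr (x : quotmod) : V := repr (x : Quotient.quot (lspan S)).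

Lemma qreprK x : qproj (qrepr x) = x.
Proof. exact: reprK. Qed.

Lemma qproj_eq u v : (qproj u == qproj v) = (u - v \in lspan S).
Proof. by rewrite Quotient.idealrBE. Qed.

Fact qproj_is_zmod_morphism : zmod_morphism qproj.
Proof. by move=> x y; apply: (raddfB (\pi_(Quotient.quot (lspan S)))). Qed.

Definition qscale (c : k) (x : quotmod) : quotmod := qproj (c *: qrepr x).

Fact qproj_scale c v : qproj (c *: v) = qscale c (qproj v).
Proof.
apply/eqP; rewrite qproj_eq -scalerBr rpredZ // -qproj_eq qreprK.
exact: eqxx.
Qed.

Fact qscaleA a b x : qscale a (qscale b x) = qscale (a * b) x.
Proof. by rewrite -[x]qreprK -!qproj_scale scalerA. Qed.

Fact qscale1 : left_id 1 qscale.
Proof. by move=> x; rewrite -[x]qreprK -!qproj_scale scale1r. Qed.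

Lemma qprojD u v : qproj (u + v) = qproj u + qproj v.
Proof.
have := qproj_is_zmod_morphism (u + v) v; rewrite addrK => ->.
by rewrite subrK.
Qed.

Fact qscaleDr : right_distributive qscale +%R.
Proof.
move=> c x y; rewrite -[x]qreprK -[y]qreprK -qprojD -!qproj_scale -qprojD.
by rewrite scalerDr.
Qed.

Fact qscaleDl x : {morph qscale^~ x : a b / a + b}.
Proof. by move=> a b; rewrite -[x]qreprK -!qproj_scale -qprojD scalerDl. Qed.

HB.instance Definition _ := GRing.Zmodule_isLmodule.Build k quotmod
  qscaleA qscale1 qscaleDr qscaleDl.

Fact qproj_is_linear : linear qproj.
Proof. by move=> c u v; rewrite qprojD qproj_scale. Qed.

HB.instance Definition _ := GRing.isLinear.Build k V quotmod _ qproj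
  qproj_is_linear.

Lemma qproj_gen x : S x -> qproj x = 0.
Proof.
move=> Sx; rewrite -(linear0 qproj); apply/eqP; rewrite qproj_eq subr0.
exact: lspan_gen.
Qed.

Section Lift.
Variables (W : lmodType k) (f : {linear V -> W}).
Hypothesis fS : forall x, S x -> f x = 0.

Definition qlift of (forall x, S x -> f x = 0) :=
  fun x : quotmod => f (qrepr x).

Lemma lin_lspan0 v : v \in lspan S -> f v = 0.
Proof.
move=> /lspanP; elim=> [|c x y Sx _ IH]; first exact: linear0.
by rewrite linearP fS // IH scaler0 addr0.
Qed.

Lemma qlift_qproj v : qlift fS (qproj v) = f v.
Proof.
apply/eqP; rewrite -subr_eq0 -linearB; apply/eqP/lin_lspan0.
by rewrite -qproj_eq qreprK.
Qed.

Fact qlift_is_linear : linear (qlift fS).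
Proof.
move=> c x y; rewrite -[x]qreprK -[y]qreprK -linearP !qlift_qproj.
exact: linearP.
Qed.

HB.instance Definition _ := GRing.isLinear.Build k quotmod W _ (qlift fS)
  qlift_is_linear.

End Lift.

Lemma quotmod_ind (P : quotmod -> Prop) :
  (forall v, P (qproj v)) -> forall x, P x.
Proof. by move=> h x; rewrite -[x]qreprK. Qed.

End Quotient.

Section FreeModule.
Variables (k : fieldType) (X : choiceType).

Definition fgen (x : X) : {freeg X / k} := << x >>.

Lemma fgenE (D : {freeg X / k}) :
  D = \sum_(x <- dom D) coeff x D *: fgen x.
Proof.
rewrite -[LHS](freeg_sumE D); apply: eq_bigr => x _.
by apply/eqP/freeg_eqP => y; rewrite coeffZ !coeffU mul1r.
Qed.

Section Lift.
Variables (W : lmodType k) (f : X -> W).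

Lemma fglift_gen x : fglift f (fgen x) = f x.
Proof. by rewrite -[RHS]scale1r; apply: liftU. Qed.

HB.instance Definition _ := GRing.isZmodMorphism.Build {freeg X / k} W
  (fglift f) (lift_is_additive f).

Fact fglift_is_scalable : scalable (fglift f).
Proof.
move=> c D; rewrite -[in RHS](freeg_sumE D) [in RHS]raddf_sum scaler_sumr.
rewrite [c *: D]/(fgscale c D) raddf_sum.
apply: eq_bigr => x _.
transitivity ((c * coeff x D) *: f x); first exact: liftU.
rewrite -scalerA; congr (_ *: _); symmetry; exact: liftU.
Qed.

HB.instance Definition _ :=
  GRing.isScalable.Build k {freeg X / k} W _ (fglift f) fglift_is_scalable.

End Lift.

End FreeModule.

Arguments fgen k {X} x.


Section Presented.
Variables (k : fieldType) (X : choiceType) (R : {freeg X / k} -> Prop).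

(* the k-module with generators X and relations R *)
Definition presmod : Type := quotmod R.
HB.instance Definition _ := GRing.Lmodule.on presmod.

Definition pgen (x : X) : presmod := qproj R (fgen k x).

Lemma presmod_eq (W : lmodType k) (f g : {linear presmod -> W}) :
  (forall x, f (pgen x) = g (pgen x)) -> f =1 g.
Proof.
have E (h : {linear presmod -> W}) D :
    h (qproj R D) = \sum_(x <- dom D) coeff x D *: h (pgen x).
  rewrite [in LHS](fgenE D) linear_sum raddf_sum; apply: eq_bigr => x _ /=.
  by rewrite -[RHS]linearZ; congr (h _); apply: linearZ.
move=> fg y; rewrite -[y](qreprK (S := R)) !E.
by apply: eq_bigr => x _; rewrite fg.
Qed.

Lemma presmod_ind (P : presmod -> Prop) : P 0 ->
  (forall c x y, P y -> P (c *: pgen x + y)) -> forall x, P x.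
Proof.
move=> P0 PD y; rewrite -[y](qreprK (S := R)) (fgenE (qrepr y)).
elim: (dom _) => [|x r IH]; first by rewrite big_nil linear0.
by rewrite big_cons linearP; apply: PD.
Qed.

Section Lift.
Variables (W : lmodType k) (f : X -> W).
Hypothesis fR : forall r, R r -> fglift f r = 0.

Definition plift : presmod -> W := qlift fR.
HB.instance Definition _ := GRing.Linear.on plift.

Lemma plift_gen x : plift (pgen x) = f x.
Proof. by rewrite /plift /pgen qlift_qproj; apply: fglift_gen. Qed.

End Lift.

Lemma pgen_rel r : R r -> fglift pgen r = 0.
Proof.
move=> Rr; rewrite -(qproj_gen Rr) [in RHS](fgenE r) [in LHS](fgenE r).
rewrite !linear_sum; apply: eq_bigr => x _.
by rewrite !linearZ /= fglift_gen.
Qed.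

End Presented.

Definition lmod_iso (k : fieldType) (V W : lmodType k) : Prop :=
  exists f : {linear V -> W}, bijective f.

Section Tensor.
Variables (k : fieldType) (I : Type) (V : I -> lmodType k).

Definition lincomb_at (i : I) (c : k) (x y z : forall j, V j) : Prop :=
  z i = c *: x i + y i /\ forall j, j <> i -> x j = z j /\ y j = z j.

Definition multilinear (W : lmodType k) (f : (forall i, V i) -> W) : Prop :=
  forall i c x y z, lincomb_at i c x y z -> f z = c *: f x + f y.

Inductive multilinear_rel : {freeg (forall i, V i) / k} -> Prop :=
| MultilinearRel i c x y z of lincomb_at i c x y z :
    multilinear_rel (fgen k z - (c *: fgen k x + fgen k y)).

(* the tensor product over k of the family V *)
Definition tensor : Type := presmod multilinear_rel.
HB.instance Definition _ := GRing.Lmodule.on tensor.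

Definition tens (x : forall i, V i) : tensor := pgen multilinear_rel x.

Section Lift.
Variables (W : lmodType k) (f : (forall i, V i) -> W).
Hypothesis fM : multilinear f.

Fact multilinear_lift_rel r : multilinear_rel r -> fglift f r = 0.
Proof.
case=> i c x y z /fM fz; rewrite linearB linearP /= !fglift_gen fz.
exact: subrr.
Qed.

Definition tlift : tensor -> W := plift multilinear_lift_rel.
HB.instance Definition _ := GRing.Linear.on tlift.

Lemma tlift_tens x : tlift (tens x) = f x.
Proof. exact: plift_gen. Qed.

End Lift.

Lemma tens_multilinear : multilinear tens.
Proof.
move=> i c x y z h; apply/eqP; rewrite -subr_eq0; apply/eqP.
have := pgen_rel (MultilinearRel h).
by rewrite linearB linearP /= !fglift_gen.
Qed.

Lemma tensor_eq (W : lmodType k) (f g : {linear tensor -> W}) :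
  (forall x, f (tens x) = g (tens x)) -> f =1 g.
Proof. exact: presmod_eq. Qed.

End Tensor.

(* Both actions are k-bilinear and unital, so the k-structures they induce
   on M through A and A' coincide with the given one. *)
HB.mixin Record isBimodule (k : fieldType) (A A' : algType k) M
    of GRing.Lmodule k M := {
  lact : A -> M -> M;
  ract : M -> A' -> M;
  lact_linear : forall a, linear (lact a);
  lact_linearl : forall m, linear (lact^~ m);
  lact1 : forall m, lact 1 m = m;
  lactA : forall a b m, lact a (lact b m) = lact (a * b) m;
  ract_linear : forall a, linear (ract^~ a);
  ract_linearr : forall m, linear (ract m);
  ract1 : forall m, ract m 1 = m;
  ractA : forall m a b, ract (ract m a) b = ract m (a * b);
  lractA : forall a m b, ract (lact a m) b = lact a (ract m b)
}.

#[short(type="bimodType")]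
HB.structure Definition Bimodule (k : fieldType) (A A' : algType k) :=
  {M of isBimodule k A A' M & GRing.Lmodule k M}.

Definition bimod_iso (k : fieldType) (A A' : algType k) (M N : bimodType A A')
    : Prop :=
  exists f : {linear M -> N}, [/\ bijective f,
    forall a m, f (lact a m) = lact a (f m) &
    forall m a, f (ract m a) = ract (f m) a].

Section Regular.
Variables (k : fieldType) (A : algType k).

Definition regular : Type := A.
HB.instance Definition _ := GRing.Lmodule.on regular.

Let rlact (a : A) (m : regular) : regular := a * (m : A).
Let rract (m : regular) (a : A) : regular := (m : A) * a.

Fact regular_lact_linear a : linear (rlact a).
Proof. by move=> c u v; rewrite /rlact mulrDr scalerAr. Qed.
Fact regular_lact_linearl m : linear (rlact^~ m).
Proof. by move=> c u v; rewrite /rlact mulrDl scalerAl. Qed.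
Fact regular_lact1 m : rlact 1 m = m.
Proof. exact: mul1r. Qed.
Fact regular_lactA a b m : rlact a (rlact b m) = rlact (a * b) m.
Proof. exact: mulrA. Qed.
Fact regular_ract1 m : rract m 1 = m.
Proof. exact: mulr1. Qed.
Fact regular_ractA m a b : rract (rract m a) b = rract m (a * b).
Proof. by rewrite /rract mulrA. Qed.
Fact regular_lractA a m b : rract (rlact a m) b = rlact a (rract m b).
Proof. by rewrite /rract /rlact mulrA. Qed.

HB.instance Definition _ := isBimodule.Build k A A regular
  regular_lact_linear regular_lact_linearl regular_lact1 regular_lactA
  regular_lact_linearl regular_lact_linear regular_ract1 regular_ractA
  regular_lractA.

End Regular.

Section BalancedTensor.
Variables (k : fieldType) (A A' A'' : algType k).
Variables (P : bimodType A A') (Q : bimodType A' A'').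

Definition balanced (W : lmodType k) (f : P * Q -> W) : Prop :=
  [/\ forall q, linear (fun p => f (p, q)),
      forall p, linear (fun q => f (p, q)) &
      forall p a q, f (ract p a, q) = f (p, lact a q)].

Inductive balanced_rel : {freeg (P * Q)%type / k} -> Prop :=
| BalancedL c p p' q : balanced_rel
    (fgen k (c *: p + p', q) - (c *: fgen k (p, q) + fgen k (p', q)))
| BalancedR c p q q' : balanced_rel
    (fgen k (p, c *: q + q') - (c *: fgen k (p, q) + fgen k (p, q')))
| BalancedA p a q : balanced_rel (fgen k (ract p a, q) - fgen k (p, lact a q)).

(* P (x)_A' Q *)
Definition btensor : Type := presmod balanced_rel.
HB.instance Definition _ := GRing.Lmodule.on btensor.

Definition btens (p : P) (q : Q) : btensor := pgen balanced_rel (p, q).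

Section Lift.
Variables (W : lmodType k) (f : P * Q -> W).
Hypothesis fB : balanced f.

Fact balanced_lift_rel r : balanced_rel r -> fglift f r = 0.
Proof.
case: fB => fl fr fa; case=> [c p p' q|c p q q'|p a q].
- by rewrite linearB linearP /= !fglift_gen fl subrr.
- by rewrite linearB linearP /= !fglift_gen fr subrr.
- by rewrite linearB /= !fglift_gen fa subrr.
Qed.

Definition blift : btensor -> W := plift balanced_lift_rel.
HB.instance Definition _ := GRing.Linear.on blift.

Lemma blift_btens p q : blift (btens p q) = f (p, q).
Proof. exact: plift_gen. Qed.

End Lift.

Lemma btens_balanced : balanced (fun pq => btens pq.1 pq.2).
Proof.
split=> [q c p p'|p c q q'|p a q]; apply/eqP; rewrite -subr_eq0; apply/eqP.
- have := pgen_rel (BalancedL c p p' q).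
  by rewrite linearB linearP /= !fglift_gen.
- have := pgen_rel (BalancedR c p q q').
  by rewrite linearB linearP /= !fglift_gen.
- have := pgen_rel (BalancedA p a q).
  by rewrite linearB /= !fglift_gen.
Qed.

Lemma btensor_eq (W : lmodType k) (f g : {linear btensor -> W}) :
  (forall p q, f (btens p q) = g (btens p q)) -> f =1 g.
Proof. by move=> fg; apply: presmod_eq => -[p q]; apply: fg. Qed.

Fact btensor_lact_balanced (a : A) :
  balanced (fun pq : P * Q => btens (lact a pq.1) pq.2).
Proof.
case: btens_balanced => bl br ba; split=> [q c p p'|p c q q'|p b q] /=.
- by rewrite lact_linear; apply: bl.
- exact: br.
- by rewrite -lractA; apply: ba.
Qed.

Fact btensor_ract_balanced (a : A'') :
  balanced (fun pq : P * Q => btens pq.1 (ract pq.2 a)).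
Proof.
case: btens_balanced => bl br ba; split=> [q c p p'|p c q q'|p b q] /=.
- exact: bl.
- by rewrite ract_linear; apply: br.
- by rewrite lractA; apply: ba.
Qed.

Definition btensor_lact a : btensor -> btensor :=
  blift (btensor_lact_balanced a).
Definition btensor_ract x a : btensor := blift (btensor_ract_balanced a) x.
Lemma btensor_lactE a p q :
  btensor_lact a (btens p q) = btens (lact a p) q.
Proof. exact: blift_btens. Qed.

Lemma btensor_ractE a p q :
  btensor_ract (btens p q) a = btens p (ract q a).
Proof. exact: blift_btens. Qed.


Lemma btensor_ind (S : btensor -> Prop) : S 0 ->
  (forall c p q y, S y -> S (c *: btens p q + y)) -> forall x, S x.
Proof. by move=> S0 SD; apply: presmod_ind => // c [p q]; apply: SD. Qed.

Fact btensor_lact_linear a : linear (btensor_lact a).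
Proof. by move=> c x y; rewrite /btensor_lact linearP. Qed.

Fact btensor_ract_linear a : linear (btensor_ract^~ a).
Proof. by move=> c x y; rewrite /btensor_ract linearP. Qed.

Fact btensor_lact_linearl x : linear (btensor_lact^~ x).
Proof.
move=> c a b; elim/btensor_ind: x => [|d p q y IH].
  by rewrite /btensor_lact !linear0 addr0.
rewrite !btensor_lact_linear IH !btensor_lactE lact_linearl.
case: btens_balanced => bl _ _; rewrite (bl q) /= !scalerDr !scalerA.
by rewrite (mulrC d c) !addrA; congr (_ + _); rewrite addrAC.
Qed.

Fact btensor_ract_linearr x : linear (btensor_ract x).
Proof.
move=> c a b; elim/btensor_ind: x => [|d p q y IH].
  by rewrite /btensor_ract !linear0 addr0.
rewrite !btensor_ract_linear IH !btensor_ractE ract_linearr.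
case: btens_balanced => _ br _; rewrite (br p) /= !scalerDr !scalerA.
by rewrite (mulrC d c) !addrA; congr (_ + _); rewrite addrAC.
Qed.

Fact btensor_lact1 x : btensor_lact 1 x = x.
Proof.
elim/btensor_ind: x => [|c p q y IH]; first by rewrite /btensor_lact linear0.
by rewrite btensor_lact_linear IH btensor_lactE lact1.
Qed.

Fact btensor_ract1 x : btensor_ract x 1 = x.
Proof.
elim/btensor_ind: x => [|c p q y IH]; first by rewrite /btensor_ract linear0.
by rewrite btensor_ract_linear IH btensor_ractE ract1.
Qed.

Fact btensor_lactA a b x :
  btensor_lact a (btensor_lact b x) = btensor_lact (a * b) x.
Proof.
elim/btensor_ind: x => [|c p q y IH]; first by rewrite /btensor_lact !linear0.
by rewrite !btensor_lact_linear IH !btensor_lactE lactA.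
Qed.

Fact btensor_ractA x a b :
  btensor_ract (btensor_ract x a) b = btensor_ract x (a * b).
Proof.
elim/btensor_ind: x => [|c p q y IH]; first by rewrite /btensor_ract !linear0.
by rewrite !btensor_ract_linear IH !btensor_ractE ractA.
Qed.

Fact btensor_lractA a x b :
  btensor_ract (btensor_lact a x) b = btensor_lact a (btensor_ract x b).
Proof.
elim/btensor_ind: x => [|c p q y IH].
  by rewrite /btensor_ract /btensor_lact !linear0.
rewrite !(btensor_lact_linear, btensor_ract_linear) IH.
by rewrite !(btensor_lactE, btensor_ractE).
Qed.

HB.instance Definition _ := isBimodule.Build k A A'' btensor
  btensor_lact_linear btensor_lact_linearl btensor_lact1 btensor_lactA
  btensor_ract_linear btensor_ract_linearr btensor_ract1 btensor_ractA
  btensor_lractA.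

End BalancedTensor.

(* 'M[A]_n as a k-algebra: the library makes 'M[A]_n a module over A, not
   over k, hence the alias *)
Definition matalg (k : fieldType) (A : algType k) (n : nat) : Type := 'M[A]_n.

Section MatrixAlgebra.
Variables (k : fieldType) (A : algType k) (n : nat).

HB.instance Definition _ := GRing.NzRing.copy (matalg A n.+1) 'M[A]_n.+1.

Let mscale (c : k) (X : matalg A n.+1) : matalg A n.+1 :=
  map_mx ( *:%R c) (X : 'M_n.+1).

Fact matalg_scaleA c d X : mscale c (mscale d X) = mscale (c * d) X.
Proof. by apply/matrixP => i j; rewrite !mxE scalerA. Qed.
Fact matalg_scale1 : left_id 1 mscale.
Proof. by move=> X; apply/matrixP => i j; rewrite !mxE scale1r. Qed.
Fact matalg_scaleDr : right_distributive mscale +%R.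
Proof. by move=> c X Y; apply/matrixP => i j; rewrite !mxE scalerDr. Qed.
Fact matalg_scaleDl X : {morph mscale^~ X : a b / a + b}.
Proof. by move=> c d; apply/matrixP => i j; rewrite !mxE scalerDl. Qed.

HB.instance Definition _ := GRing.Zmodule_isLmodule.Build k (matalg A n.+1)
  matalg_scaleA matalg_scale1 matalg_scaleDr matalg_scaleDl.

Fact matalg_scaleAl (c : k) (X Y : matalg A n.+1) :
  c *: (X * Y) = c *: X * Y.
Proof.
apply/matrixP => i j; rewrite !mxE scaler_sumr; apply: eq_bigr => l _.
by rewrite mxE scalerAl.
Qed.
Fact matalg_scaleAr (c : k) (X Y : matalg A n.+1) :
  c *: (X * Y) = X * (c *: Y).
Proof.
apply/matrixP => i j; rewrite !mxE scaler_sumr; apply: eq_bigr => l _.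
by rewrite mxE scalerAr.
Qed.

HB.instance Definition _ :=
  GRing.Lmodule_isLalgebra.Build k (matalg A n.+1) matalg_scaleAl.
HB.instance Definition _ :=
  GRing.Lalgebra_isAlgebra.Build k (matalg A n.+1) matalg_scaleAr.

End MatrixAlgebra.

Section ScalarMatrix.
Variables (k : fieldType) (B : comAlgType k) (n : nat).

Definition scalar_pred : {pred matalg B n.+1} :=
  fun X => is_scalar_mx (X : 'M[B]_n.+1).

Lemma scalar_predP (X : matalg B n.+1) :
  reflect (exists b : B, X = b%:M :> 'M[B]_n.+1) (X \in scalar_pred).
Proof. exact: is_scalar_mxP. Qed.

Fact scalar_closed : GRing.subsemialg_closed scalar_pred.
Proof.
split; first by apply/scalar_predP; exists 1.
- split; first by apply/scalar_predP; exists 0; rewrite raddf0.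
  move=> X Y /scalar_predP[x ->] /scalar_predP[y ->]; apply/scalar_predP.
  by exists (x + y); rewrite raddfD.
- move=> c X /scalar_predP[x ->]; apply/scalar_predP; exists (c *: x).
  by apply/matrixP => i j; rewrite !mxE scalerMnr.
- move=> X Y /scalar_predP[x ->] /scalar_predP[y ->]; apply/scalar_predP.
  by exists (x * y); rewrite scalar_mxM.
Qed.

HB.instance Definition _ :=
  GRing.isSubalgClosed.Build k (matalg B n.+1) scalar_pred scalar_closed.

(* I_n(B), as a subalgebra of M_n(B), for matrices of size n.+1 *)
Record scalmx := ScalarMx
  { scalmx_val :> matalg B n.+1; scalmx_valP : scalmx_val \in scalar_pred }.
HB.instance Definition _ := [isSub for scalmx_val].
HB.instance Definition _ := [Choice of scalmx by <:].
HB.instance Definition _ := [SubChoice_isSubAlgebra of scalmx by <:].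


Fact scalmx_mulC (X Y : scalmx) : X * Y = Y * X.
Proof.
apply: val_inj; rewrite !rmorphM /=.
case/scalar_predP: (scalmx_valP X) => x ->.
case/scalar_predP: (scalmx_valP Y) => y ->.
by rewrite -[LHS]scalar_mxM -[RHS]scalar_mxM mulrC.
Qed.
HB.instance Definition _ :=
  GRing.PzRing_hasCommutativeMul.Build scalmx scalmx_mulC.
HB.instance Definition _ := GRing.Lalgebra_isComAlgebra.Build k scalmx.

Definition scalmx_entry (X : scalmx) : B := (val X : 'M[B]_n.+1) 0 0.

Lemma scalmxE (X : scalmx) : val X = (scalmx_entry X)%:M :> 'M[B]_n.+1.
Proof.
rewrite /scalmx_entry; case/scalar_predP: (scalmx_valP X) => x /= ->.
by rewrite mxE eqxx mulr1n.
Qed.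

End ScalarMatrix.

Record triple (k : fieldType) := Triple {
  tA : algType k;
  tB : comAlgType k;
  teps : {lrmorphism tB -> tA};
  teps_central : forall (b : tB) (a : tA), teps b * a = a * teps b
}.

Definition Bsymmetric (k : fieldType) (T : triple k)
    (M : bimodType (tA T) (tA T)) : Prop :=
  forall (m : M) (b : tB T), ract m (teps T b) = lact (teps T b) m.

Definition morita_equiv (k : fieldType) (T T' : triple k) : Prop :=
  exists (P : bimodType (tA T) (tA T')) (Q : bimodType (tA T') (tA T))
         (eta : {lrmorphism tB T -> tB T'}),
    [/\ bimod_iso (btensor P Q) (regular (tA T)),
        bimod_iso (btensor Q P) (regular (tA T')),
        bijective eta,
        forall (b : tB T) (p : P),
          lact (teps T b) p = ract p (teps T' (eta b)) &
        forall (b : tB T) (q : Q),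
          ract q (teps T b) = lact (teps T' (eta b)) q].

Section LinearFun.
Variables (k : fieldType) (V W : lmodType k) (f : V -> W).
Hypothesis lf : linear f.

Lemma linear_fun0 : f 0 = 0.
Proof.
have := lf 1 0 0; rewrite !scale1r addr0 => /eqP.
by rewrite -subr_eq subrr eq_sym => /eqP.
Qed.

Lemma linear_funD x y : f (x + y) = f x + f y.
Proof. by have := lf 1 x y; rewrite !scale1r. Qed.

Lemma linear_fun_sum I (r : seq I) (F : I -> V) :
  f (\sum_(i <- r) F i) = \sum_(i <- r) f (F i).
Proof.
elim: r => [|i r IH]; first by rewrite !big_nil linear_fun0.
by rewrite !big_cons linear_funD IH.
Qed.

End LinearFun.

Section MatrixTriple.
Variables (k : fieldType) (T : triple k) (n : nat).
Local Notation A := (tA T).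
Local Notation B := (tB T).

Definition mat_eps (X : scalmx B n) : matalg A n.+1 :=
  (teps T (scalmx_entry X))%:M.

Fact mat_eps_is_linear : linear mat_eps.
Proof.
move=> c X Y; apply/matrixP => i j; rewrite !mxE.
by rewrite /scalmx_entry !mxE linearP /= mulrnDl scalerMnr.
Qed.
HB.instance Definition _ := GRing.isLinear.Build k (scalmx B n)
  (matalg A n.+1) _ mat_eps mat_eps_is_linear.

Fact mat_eps_is_monoid_morphism : monoid_morphism mat_eps.
Proof.
split; first by rewrite /mat_eps /scalmx_entry mxE eqxx rmorph1.
move=> X Y; rewrite /mat_eps.
have -> : scalmx_entry (X * Y) = scalmx_entry X * scalmx_entry Y.
  rewrite {1}/scalmx_entry rmorphM /= [scalmx_val X]scalmxE.
  by rewrite [scalmx_val Y]scalmxE -[_ * _]scalar_mxM mxE eqxx mulr1n.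
by rewrite rmorphM; apply: scalar_mxM.
Qed.
HB.instance Definition _ := GRing.isMonoidMorphism.Build (scalmx B n)
  (matalg A n.+1) mat_eps mat_eps_is_monoid_morphism.

Fact mat_eps_central (X : scalmx B n) (Y : matalg A n.+1) :
  mat_eps X * Y = Y * mat_eps X.
Proof.
apply/matrixP => i j; rewrite !mxE (bigD1 i) // [RHS](bigD1 j) //=.
rewrite !big1 => [|l /negPf lj|l /negPf li]; last first.
- by rewrite mxE eq_sym li mulr0n mul0r.
- by rewrite mxE lj mulr0n mulr0.
by rewrite !mxE !eqxx !mulr1n !addr0 teps_central.
Qed.

(* (M_n(A), I_n(B), eps_* ), again for matrices of size n.+1 *)
Definition mat_triple : triple k := Triple mat_eps_central.

End MatrixTriple.

Definition matmod (k : fieldType) (A : algType k) (M : bimodType A A)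
  (n : nat) : Type := 'M[M]_n.

Section MatrixBimodule.
Variables (k : fieldType) (A : algType k) (M : bimodType A A) (n : nat).

HB.instance Definition _ := GRing.Zmodule.copy (matmod M n) 'M[M]_n.

Let mscale (c : k) (X : matmod M n) : matmod M n :=
  map_mx ( *:%R c) (X : 'M_n).

Fact matmod_scaleA c d X : mscale c (mscale d X) = mscale (c * d) X.
Proof. by apply/matrixP => i j; rewrite !mxE scalerA. Qed.
Fact matmod_scale1 : left_id 1 mscale.
Proof. by move=> X; apply/matrixP => i j; rewrite !mxE scale1r. Qed.
Fact matmod_scaleDr : right_distributive mscale +%R.
Proof. by move=> c X Y; apply/matrixP => i j; rewrite !mxE scalerDr. Qed.
Fact matmod_scaleDl X : {morph mscale^~ X : a b / a + b}.
Proof. by move=> c d; apply/matrixP => i j; rewrite !mxE scalerDl. Qed.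

HB.instance Definition _ := GRing.Zmodule_isLmodule.Build k (matmod M n)
  matmod_scaleA matmod_scale1 matmod_scaleDr matmod_scaleDl.

End MatrixBimodule.

Section MatrixAction.
Variables (k : fieldType) (A : algType k) (M : bimodType A A) (n : nat).

Definition mat_lact (X : matalg A n.+1) (Y : matmod M n.+1) : matmod M n.+1 :=
  \matrix_(i, j) \sum_l lact ((X : 'M_n.+1) i l) ((Y : 'M_n.+1) l j).

Definition mat_ract (Y : matmod M n.+1) (X : matalg A n.+1) : matmod M n.+1 :=
  \matrix_(i, j) \sum_l ract ((Y : 'M_n.+1) i l) ((X : 'M_n.+1) l j).

Fact mat_lact_linear X : linear (mat_lact X).
Proof.
move=> c Y Z; apply/matrixP => i j; rewrite !mxE scaler_sumr -big_split.
by apply: eq_bigr => l _; rewrite !mxE lact_linear.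
Qed.
Fact mat_lact_linearl Y : linear (mat_lact^~ Y).
Proof.
move=> c X Z; apply/matrixP => i j; rewrite !mxE scaler_sumr -big_split.
by apply: eq_bigr => l _; rewrite !mxE lact_linearl.
Qed.
Fact mat_ract_linear X : linear (mat_ract^~ X).
Proof.
move=> c Y Z; apply/matrixP => i j; rewrite !mxE scaler_sumr -big_split.
by apply: eq_bigr => l _; rewrite !mxE ract_linear.
Qed.
Fact mat_ract_linearr Y : linear (mat_ract Y).
Proof.
move=> c X Z; apply/matrixP => i j; rewrite !mxE scaler_sumr -big_split.
by apply: eq_bigr => l _; rewrite !mxE ract_linearr.
Qed.
Fact mat_lact1 Y : mat_lact 1 Y = Y.
Proof.
apply/matrixP => i j; rewrite !mxE (bigD1 i) //= mxE eqxx lact1.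
rewrite big1 ?addr0 // => l /negPf li.
by rewrite mxE eq_sym li (linear_fun0 (lact_linearl _)).
Qed.
Fact mat_ract1 Y : mat_ract Y 1 = Y.
Proof.
apply/matrixP => i j; rewrite !mxE (bigD1 j) //= mxE eqxx ract1.
rewrite big1 ?addr0 // => l /negPf lj.
by rewrite mxE lj (linear_fun0 (ract_linearr _)).
Qed.
Fact mat_lactA X Z Y : mat_lact X (mat_lact Z Y) = mat_lact (X * Z) Y.
Proof.
apply/matrixP => i j; rewrite !mxE.
under eq_bigr do rewrite mxE (linear_fun_sum (lact_linear _)).
rewrite exchange_big; apply: eq_bigr => l _; rewrite mxE.
rewrite (linear_fun_sum (lact_linearl _)).
by apply: eq_bigr => h _; rewrite lactA.
Qed.
Fact mat_ractA Y X Z : mat_ract (mat_ract Y X) Z = mat_ract Y (X * Z).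
Proof.
apply/matrixP => i j; rewrite !mxE.
under eq_bigr do rewrite mxE (linear_fun_sum (ract_linear _)).
rewrite exchange_big; apply: eq_bigr => l _; rewrite mxE.
rewrite (linear_fun_sum (ract_linearr _)).
by apply: eq_bigr => h _; rewrite ractA.
Qed.
Fact mat_lractA X Y Z : mat_ract (mat_lact X Y) Z = mat_lact X (mat_ract Y Z).
Proof.
apply/matrixP => i j; rewrite !mxE.
under eq_bigr do rewrite mxE (linear_fun_sum (ract_linear _)).
rewrite exchange_big; apply: eq_bigr => l _; rewrite mxE.
rewrite (linear_fun_sum (lact_linear _)).
by apply: eq_bigr => h _; rewrite lractA.
Qed.

HB.instance Definition _ :=
  isBimodule.Build k (matalg A n.+1) (matalg A n.+1) (matmod M n.+1)
    mat_lact_linear mat_lact_linearl mat_lact1 mat_lactA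
    mat_ract_linear mat_ract_linearr mat_ract1 mat_ractA mat_lractA.

End MatrixAction.

Lemma matmod_Bsymmetric (k : fieldType) (T : triple k) n
    (M : bimodType (tA T) (tA T)) :
  Bsymmetric M -> Bsymmetric (T := mat_triple T n) (matmod M n.+1).
Proof.
move=> MB Y X; apply/matrixP => i j; rewrite !mxE.
rewrite (bigD1 j) // [RHS](bigD1 i) //=.
rewrite !big1 => [|l /negPf li|l /negPf lj].
- by rewrite !addr0 !mxE !eqxx !mulr1n MB.
- by rewrite mxE eq_sym li (linear_fun0 (lact_linearl _)).
- by rewrite mxE lj (linear_fun0 (ract_linearr _)).
Qed.

Section SecondaryHochschild.
Variables (k : fieldType) (T : triple k) (M : bimodType (tA T) (tA T)).
Local Notation A := (tA T).
Local Notation B := (tB T).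
Local Notation eps := (teps T).

(* The factors of C_n = M (x) A^n (x) B^(n(n-1)/2): M itself, the diagonal
   entries and the entries strictly above the diagonal of the n x n array.
   Rows and columns are numbered from 0, so that b_{p+1,q+1} is upper x p q. *)
Inductive slot (n : nat) : Type :=
| Coef
| Diag (i : 'I_n)
| Upper (p q : 'I_n) of (p < q)%N.

Definition slot_mod n (s : slot n) : lmodType k :=
  match s with Coef => M | Diag _ => A | Upper _ _ _ => B end.

Definition array n : Type := forall s : slot n, slot_mod s.

Definition mkarray n (m : M) (a : 'I_n -> A) (b : 'I_n -> 'I_n -> B) :
    array n := fun s =>
  match s with Coef => m | Diag i => a i | Upper p q _ => b p q end.

Definition coef n (x : array n) : M := x (Coef n).
Definition diag n (x : array n) (i : 'I_n) : A := x (Diag i).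
(* 1 outside the strict upper triangle *)
Definition upper n (x : array n) (p q : 'I_n) : B :=
  match @idP (p < q)%N with
  | ReflectT pq => x (Upper pq)
  | ReflectF _ => 1
  end.

Definition chain n : lmodType k := tensor (@slot_mod n).

(* face_first, face_mid j (j < n) and face_last are delta_0, delta_(j+1) and
   delta_(n+1) on C_(n+1). Below, lift ord_max p and lift ord0 p are the
   indices of values p and p+1. *)
Definition face_first n (x : array n.+1) : array n :=
  mkarray
    (ract (coef x)
       (diag x ord0 * eps (\prod_(q < n) upper x ord0 (lift ord0 q))))
    (fun i => diag x (lift ord0 i))
    (fun p q => upper x (lift ord0 p) (lift ord0 q)).

Definition face_last n (x : array n.+1) : array n :=
  mkarray
    (lact
       (diag x ord_max * eps (\prod_(p < n) upper x (lift ord_max p) ord_max))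
       (coef x))
    (fun i => diag x (lift ord_max i))
    (fun p q => upper x (lift ord_max p) (lift ord_max q)).

Definition face_mid n (j : 'I_n) (x : array n.+1) : array n :=
  let w := lift (@ord_max n) in
  let s := lift (@ord0 n) in
  mkarray (coef x)
    (fun p =>
       if (p < j)%N then diag x (w p)
       else if p == j then
         diag x (w p) * eps (upper x (w p) (s p)) * diag x (s p)
       else diag x (s p))
    (fun p q =>
       if (q < j)%N then upper x (w p) (w q)
       else if q == j then upper x (w p) (w q) * upper x (w p) (s q)
       else if (p < j)%N then upper x (w p) (s q)
       else if p == j then upper x (w p) (s q) * upper x (s p) (s q)
       else upper x (s p) (s q)).

Lemma upperE n (x : array n) (p q : 'I_n) (pq : (p < q)%N) :
  upper x p q = x (Upper pq).
Proof.
rewrite /upper; case: {-}_ / idP => [pq'|//].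
by rewrite (bool_irrelevance pq pq').
Qed.

Lemma upper_neq n (x y : array n) (p q : 'I_n) :
  (forall pq : (p < q)%N, x (Upper pq) = y (Upper pq)) ->
  upper x p q = upper y p q.
Proof. by rewrite /upper => h; case: {-}_ / idP. Qed.

Lemma lincomb_coef n c (x y z : array n) : lincomb_at (Coef n) c x y z ->
  [/\ coef z = c *: coef x + coef y,
      diag x = diag z /\ diag y = diag z, upper x = upper z &
      upper y = upper z].
Proof.
case=> zE h; split=> //.
- by split; apply/funext => i; case: (h (Diag i)).
- by do 2![apply/funext => ?]; apply: upper_neq => pq; case: (h (Upper pq)).
- by do 2![apply/funext => ?]; apply: upper_neq => pq; case: (h (Upper pq)).
Qed.

Lemma lincomb_diag n i c (x y z : array n) : lincomb_at (Diag i) c x y z ->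
  [/\ diag z i = c *: diag x i + diag y i,
      coef x = coef z /\ coef y = coef z,
      forall j, j != i -> diag x j = diag z j /\ diag y j = diag z j,
      upper x = upper z & upper y = upper z].
Proof.
case=> zE h; split=> // [|j ji||].
- exact: (h (Coef n)).
- by apply: (h (Diag j)) => -[] /eqP; apply/negP.
- by do 2![apply/funext => ?]; apply: upper_neq => pq; case: (h (Upper pq)).
- by do 2![apply/funext => ?]; apply: upper_neq => pq; case: (h (Upper pq)).
Qed.

Lemma lincomb_upper n (p q : 'I_n) (pq : (p < q)%N) c (x y z : array n) :
  lincomb_at (Upper pq) c x y z ->
  [/\ upper z p q = c *: upper x p q + upper y p q,
      coef x = coef z /\ coef y = coef z,
      diag x = diag z, diag y = diag z &
      forall p' q' : 'I_n, (p' != p :> nat) || (q' != q :> nat) ->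
        upper x p' q' = upper z p' q' /\ upper y p' q' = upper z p' q'].
Proof.
case=> zE h; split=> [||||p' q' d].
- by rewrite !(upperE _ pq).
- exact: (h (Coef n)).
- by apply/funext => i; case: (h (Diag i)).
- by apply/funext => i; case: (h (Diag i)).
have d' pq' : @Upper n p' q' pq' <> Upper pq.
  by case=> pp qq; move: d; rewrite pp qq !eqxx.
split; apply: upper_neq => pq'.
- exact: (h _ (d' pq')).1.
- exact: (h _ (d' pq')).2.
Qed.

Definition array_multilinear m n (F : array m -> array n) : Prop :=
  forall s c x y z, lincomb_at s c x y z ->
  exists t, lincomb_at t c (F x) (F y) (F z).

Lemma face_firstM n : array_multilinear (@face_first n).
Proof.
case=> [|i|p q pq] c x y z.
- move=> /lincomb_coef[zE [dx dy] ux uy]; exists (Coef n); rewrite /lincomb_at /face_first /mkarray /=; split.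
    by rewrite zE dx dy ux uy ract_linear.
  by case=> //= *; rewrite ?dx ?dy ?ux ?uy.
- move=> /lincomb_diag[zE [cx cy] d ux uy].
  case: (unliftP ord0 i) zE d => [j ->|->] zE d.
    exists (Diag j); rewrite /lincomb_at /face_first /mkarray /=; split; first by [].
    have [dx0 dy0] := d ord0 isT.
    case=> [|j'|p q pq] j'j /=; rewrite ?dx0 ?dy0 ?ux ?uy ?cx ?cy //.
    apply: d; rewrite (inj_eq lift_inj); apply/eqP => jj.
    by apply: j'j; rewrite jj.
  exists (Coef n); rewrite /lincomb_at /face_first /mkarray /=; split.
    rewrite zE cx cy ux uy mulrDl -scalerAl.
    exact: ract_linearr.
  by case=> //= [j|p q pq] _; rewrite ?ux ?uy; first exact: d.
- move=> /lincomb_upper[zE [cx cy] dx dy u].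
  case: (unliftP ord0 q) pq zE u => [q' ->|-> //] pq zE u.
  case: (unliftP ord0 p) pq zE u => [p' ->|->] pq zE u.
    have pq' : (p' < q')%N by move: pq; rewrite !lift0.
    exists (Upper pq'); rewrite /lincomb_at /face_first /mkarray /=; split; first by [].
    have ux0 r : upper x ord0 (lift ord0 r) = upper z ord0 (lift ord0 r).
      by apply: (u _ _ _).1; rewrite !lift0.
    have uy0 r : upper y ord0 (lift ord0 r) = upper z ord0 (lift ord0 r).
      by apply: (u _ _ _).2; rewrite !lift0.
    case=> [|j|r s rs] neq /=; rewrite ?dx ?dy //.
      rewrite cx cy; split; congr (ract _ (_ * eps _));
        by apply: eq_bigr => r _.
    apply: u; rewrite !lift0 !eqSS; move: neq.
    have [/val_inj rp|//] := eqVneq (r : nat) p'.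
    have [/val_inj sq|//] := eqVneq (s : nat) q'.
    by move: rs; rewrite rp sq => rs []; rewrite (bool_irrelevance rs pq').
  exists (Coef n); rewrite /lincomb_at /face_first /mkarray /=; split.
    rewrite dx dy cx cy (bigD1 q') // [in RHS](bigD1 q') //.
    rewrite [X in _ + ract _ (_ * eps X)](bigD1 q') //= zE.
    set b := \prod_(r < n | _) _; set b1 := \prod_(r < n | _) _.
    set b2 := \prod_(r < n | _) _.
    have u' r : r != q' -> upper x ord0 (lift ord0 r) = upper z ord0 (lift ord0 r)
        /\ upper y ord0 (lift ord0 r) = upper z ord0 (lift ord0 r).
      by move=> rq; apply: u; rewrite !lift0 eqSS orbC; apply/orP; left.
    have -> : b1 = b by apply: eq_bigr => r /u'[].
    have -> : b2 = b by apply: eq_bigr => r /u'[].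
    rewrite mulrDl -scalerAl linearP mulrDr -scalerAr.
    exact: ract_linearr.
  case=> [//|j|r s rs] _ /=; rewrite ?dx ?dy //.
  by apply: u; rewrite !lift0.
Qed.

Lemma face_lastM n : array_multilinear (@face_last n).
Proof.
have le (i : 'I_n) : lift ord_max i = i :> nat := lift_max i.
have lt (i : 'I_n) : (lift ord_max i == n :> nat) = false.
  by rewrite lift_max; apply/eqP; have := ltn_ord i; lia.
case=> [|i|p q pq] c x y z.
- move=> /lincomb_coef[zE [dx dy] ux uy]; exists (Coef n); rewrite /lincomb_at /face_last /mkarray /=; split.
    by rewrite zE dx dy ux uy lact_linear.
  by case=> //= *; rewrite ?dx ?dy ?ux ?uy.
- move=> /lincomb_diag[zE [cx cy] d ux uy].
  case: (unliftP ord_max i) zE d => [j ->|->] zE d.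
    exists (Diag j); rewrite /lincomb_at /face_last /mkarray /=; split; first by [].
    have [dx0 dy0] := d ord_max (neq_lift _ _).
    case=> [|j'|p q pq] j'j /=; rewrite ?dx0 ?dy0 ?ux ?uy ?cx ?cy //.
    apply: d; rewrite (inj_eq lift_inj); apply/eqP => jj.
    by apply: j'j; rewrite jj.
  exists (Coef n); rewrite /lincomb_at /face_last /mkarray /=; split.
    rewrite zE cx cy ux uy mulrDl -scalerAl.
    exact: lact_linearl.
  case=> //= [j|p q pq] _; rewrite ?ux ?uy; last by [].
  by apply: d; rewrite eq_sym neq_lift.
- move=> /lincomb_upper[zE [cx cy] dx dy u].
  have pn : (p < n)%N by have := ltn_ord q; lia.
  case: (unliftP ord_max p) pq zE u => [p' ->|pE] pq zE u; last first.
    by move: pn; rewrite pE ltnn.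
  case: (unliftP ord_max q) pq zE u => [q' ->|->] pq zE u.
    have pq' : (p' < q')%N by move: pq; rewrite !le.
    exists (Upper pq'); rewrite /lincomb_at /face_last /mkarray /=; split; first by [].
    have u' r : upper x (lift ord_max r) ord_max = upper z (lift ord_max r) ord_max
      /\ upper y (lift ord_max r) ord_max = upper z (lift ord_max r) ord_max.
      by apply: u; rewrite [in X in _ || X]eq_sym lt orbT.
    case=> [|j|r s rs] neq /=; rewrite ?dx ?dy //.
      rewrite cx cy; split; congr (lact (_ * eps _) _);
        by apply: eq_bigr => r _; case: (u' r).
    apply: u; rewrite !le; move: neq.
    have [/val_inj rp|//] := eqVneq (r : nat) p'.
    have [/val_inj sq|//] := eqVneq (s : nat) q'.
    by move: rs; rewrite rp sq => rs []; rewrite (bool_irrelevance rs pq').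
  exists (Coef n); rewrite /lincomb_at /face_last /mkarray /=; split.
    rewrite dx dy cx cy (bigD1 p') // [in RHS](bigD1 p') //.
    rewrite [X in _ + lact (_ * eps X) _](bigD1 p') //= zE.
    set b := \prod_(r < n | _) _; set b1 := \prod_(r < n | _) _.
    set b2 := \prod_(r < n | _) _.
    have u' r : r != p' -> upper x (lift ord_max r) ord_max = upper z (lift ord_max r) ord_max
        /\ upper y (lift ord_max r) ord_max = upper z (lift ord_max r) ord_max.
      by move=> rp; apply: u; rewrite !le; apply/orP; left.
    have -> : b1 = b by apply: eq_bigr => r /u'[].
    have -> : b2 = b by apply: eq_bigr => r /u'[].
    rewrite mulrDl -scalerAl linearP mulrDr -scalerAr.
    exact: lact_linearl.
  case=> [//|j|r s rs] _ /=; rewrite ?dx ?dy //.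
  by apply: u; rewrite lt orbT.
Qed.

Lemma face_midM n (j : 'I_n) : array_multilinear (face_mid j).
Proof.
pose w : 'I_n -> 'I_n.+1 := lift (@ord_max n).
pose s : 'I_n -> 'I_n.+1 := lift (@ord0 n).
have wE (p : 'I_n) : w p = p :> nat := lift_max p.
have sE (p : 'I_n) : s p = p.+1 :> nat := lift0 p.
have jn := ltn_ord j.
have sigP (i : 'I_n.+1) : {t : 'I_n | t = (i - (j < i))%N :> nat}.
  have lt : (i - (j < i) < n)%N by have := ltn_ord i; lia.
  by exists (Ordinal lt).
have wi (p : 'I_n) (i : 'I_n.+1) : p = i :> nat -> w p = i.
  by move=> pi; apply/val_inj; exact: etrans (wE p) pi.
have si (p : 'I_n) (i : 'I_n.+1) : p.+1 = i :> nat -> s p = i.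
  by move=> pi; apply/val_inj; exact: etrans (sE p) pi.
have nE m (a b : 'I_m) : (a != b) = (a != b :> nat) by [].
case=> [|i|p q pq] c x y z.
- move=> /lincomb_coef[zE [dx dy] ux uy]; exists (Coef n).
  rewrite /lincomb_at /face_mid /mkarray /=; split; first exact: zE.
  by case=> //= *; rewrite ?dx ?dy ?ux ?uy.
- move=> /lincomb_diag[zE [cx cy] d ux uy].
  have [t tE] := sigP i; exists (Diag t).
  rewrite /lincomb_at /face_mid /mkarray -/w -/s /= ux uy; split.
    case: ifP => [tj|/negbT]; first by rewrite (wi t i) //; lia.
    rewrite -leqNgt => jt; case: eqP => [tj|/eqP tj].
      have [iw|iw] := eqVneq (w t) i.
        have [-> ->] : diag x (s t) = diag z (s t) /\ diag y (s t) = diag z (s t).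
          by apply: d; rewrite -iw nE sE wE; lia.
        by rewrite iw zE !mulrDl -!scalerAl.
      have [-> ->] := d _ iw.
      have -> : s t = i.
        by apply: si; move: iw; rewrite nE wE; have := congr1 val tj => /=; lia.
      by rewrite zE !mulrDr -!scalerAr.
    by rewrite (si t i) // tE; move: tj; rewrite nE; lia.
  case=> [|p|p q pq] neq; [by []| |by []].
  have pt : p != t :> nat.
    by apply/eqP => /val_inj pt; apply: neq; rewrite pt.
  case: ifP => [pj|/negbT].
    by apply: d; rewrite nE wE; lia.
  rewrite -leqNgt => jp; case: eqP => [pj|/eqP pj].
    have pj' : p = j :> nat by rewrite pj.
    have [-> ->] : diag x (w p) = diag z (w p) /\ diag y (w p) = diag z (w p).
      by apply: d; rewrite nE wE; lia.
    have [-> ->] : diag x (s p) = diag z (s p) /\ diag y (s p) = diag z (s p).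
      by apply: d; rewrite nE sE; lia.
    by [].
  by move: pj; rewrite nE => pj; apply: d; rewrite nE sE; lia.
- move=> /lincomb_upper[zE [cx cy] dx dy u].
  have off (a b : 'I_n.+1) : (a != p :> nat) || (b != q :> nat) ->
      (upper x a b = upper z a b) * (upper y a b = upper z a b).
    by case/u.
  have [pqj|pqj] := boolP ((p == j :> nat) && (q == j.+1 :> nat)).
    have /andP[/eqP pj /eqP qj] := pqj.
    exists (Diag j).
    rewrite /lincomb_at /face_mid /mkarray -/w -/s /= ltnn eqxx dx dy; split.
      rewrite (wi j p) // (si j q) // zE linearP mulrDr mulrDl.
      by rewrite -scalerAr -scalerAl.
    case=> [|r|r t rt] neq /=; first by rewrite cx cy.
      case: ifP => // _; case: eqP => // rj; case: neq; rewrite rj; done.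
    case: ifP => [tj|/negbT tj]; first by rewrite !off ?wE //; lia.
    case: eqP => [/(congr1 val) /= tj'|/eqP]; last rewrite nE => tj'.
      by rewrite !off ?wE ?sE //; lia.
    case: ifP => [rj|/negbT rj]; first by rewrite !off ?wE ?sE //; lia.
    case: eqP => [/(congr1 val) /= rj'|/eqP]; last rewrite nE => rj'.
      by rewrite !off ?wE ?sE //; lia.
    by rewrite !off ?wE ?sE //; lia.
  have [p' pE] := sigP p; have [q' qE] := sigP q.
  have pq' : (p' < q')%N by lia.
  exists (Upper pq').
  rewrite /lincomb_at /face_mid /mkarray -/w -/s /= dx dy; split.
    case: ifP => [tj|/negbT tj].
      by rewrite (wi p' p) ?(wi q' q) //; lia.
    case: eqP => [/(congr1 val) /= tj'|/eqP]; last rewrite nE => tj'.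
      rewrite (wi p' p); last by lia.
      have [qj|qj] := leqP q j.
        rewrite (wi q' q); last by lia.
        have [-> ->] := u p (s q') ltac:(rewrite sE; lia).
        by rewrite zE mulrDl -scalerAl.
      rewrite (si q' q); last by lia.
      have [-> ->] := u p (w q') ltac:(rewrite wE; lia).
      by rewrite zE mulrDr -scalerAr.
    rewrite (si q' q); last by lia.
    case: ifP => [rj|/negbT rj]; first by rewrite (wi p' p) //; lia.
    case: eqP => [/(congr1 val) /= rj'|/eqP]; last rewrite nE => rj'.
      have [pj|pj] := leqP p j.
        rewrite (wi p' p); last by lia.
        have [-> ->] := u (s p') q ltac:(rewrite sE; lia).
        by rewrite zE mulrDl -scalerAl.
      rewrite (si p' p); last by lia.
      have [-> ->] := u (w p') q ltac:(rewrite wE; lia).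
      by rewrite zE mulrDr -scalerAr.
    by rewrite (si p' p) //; lia.
  case=> [|r|r t rt] neq /=; first by rewrite cx cy.
    case: ifP => // _; case: eqP => // /(congr1 val) /= rj.
    by rewrite !off ?wE ?sE //; lia.
  have rt' : (r != p' :> nat) || (t != q' :> nat).
    have [/val_inj rp|//] := eqVneq (r : nat) p'.
    have [/val_inj sq|//] := eqVneq (t : nat) q'.
    by move: rt neq; rewrite rp sq => rs []; rewrite (bool_irrelevance rs pq').
  case: ifP => [tj|/negbT tj]; first by rewrite !off ?wE //; lia.
  case: eqP => [/(congr1 val) /= tj'|/eqP]; last rewrite nE => tj'.
    by rewrite !off ?wE ?sE //; lia.
  case: ifP => [rj|/negbT rj]; first by rewrite !off ?wE ?sE //; lia.
  case: eqP => [/(congr1 val) /= rj'|/eqP]; last rewrite nE => rj'.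
    by rewrite !off ?wE ?sE //; lia.
  by rewrite !off ?wE ?sE //; lia.
Qed.

Lemma tens_array_multilinear m n (F : array m -> array n) :
  array_multilinear F -> multilinear (fun x => tens (F x)).
Proof.
by move=> FM s c x y z /FM[t]; apply: tens_multilinear.
Qed.

Definition face m n (F : array m -> array n) (FM : array_multilinear F) :
  {linear chain m -> chain n} := tlift (tens_array_multilinear FM).

Definition differential n : chain n -> chain n.-1 :=
  match n with
  | 0 => fun=> 0
  | m.+1 => fun x =>
      face (@face_firstM m) x
      + \sum_(j < m) (-1) ^+ j.+1 *: face (face_midM j) x
      + (-1) ^+ m.+1 *: face (@face_lastM m) x
  end.

Fact differential_is_linear n : linear (@differential n).
Proof.
case: n => [|m] c x y /=; first by rewrite scaler0 addr0.
rewrite !linearP /= !scalerDr.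
under eq_bigr do rewrite linearP scalerDr scalerA mulrC -scalerA.
rewrite big_split /= -scaler_sumr.
by rewrite [X in _ = X]addrACA [X in _ = X + _]addrACA.
Qed.
HB.instance Definition _ n := GRing.isLinear.Build k (chain n) (chain n.-1) _
  (@differential n) (@differential_is_linear n).

Lemma differential_tens m (x : array m.+1) :
  differential (tens x) =
    tens (face_first x) + \sum_(j < m) (-1) ^+ j.+1 *: tens (face_mid j x)
    + (-1) ^+ m.+1 *: tens (face_last x).
Proof.
rewrite /= /face !tlift_tens; congr (_ + _ + _).
by apply: eq_bigr => j _; rewrite tlift_tens.
Qed.

End SecondaryHochschild.

Section Homology.
Variables (k : fieldType) (U V W : lmodType k).
Variables (d1 : {linear U -> V}) (d0 : {linear V -> W}).

Definition ker_pred : {pred V} := fun v => d0 v == 0.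

Fact ker_closed : GRing.subsemimod_closed ker_pred.
Proof.
split; first split.
- by rewrite unfold_in /ker_pred linear0.
- move=> u v; rewrite !unfold_in /ker_pred => /eqP u0 /eqP v0.
  by rewrite linearD u0 v0 addr0.
- by move=> c v; rewrite !unfold_in /ker_pred => /eqP v0; rewrite linearZ_LR v0 scaler0.
Qed.
HB.instance Definition _ := GRing.isSubmodClosed.Build k V ker_pred ker_closed.

Record cycles := Cycle { cycle_val :> V; cycle_valP : cycle_val \in ker_pred }.
HB.instance Definition _ := [isSub for cycle_val].
HB.instance Definition _ := [Choice of cycles by <:].
HB.instance Definition _ := [SubChoice_isSubLmodule of cycles by <:].

Definition boundary (z : cycles) : Prop := exists u, d1 u = cycle_val z.

(* ker d0 / im d1; the boundaries already form a submodule of the cycles *)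
Definition homology : lmodType k := quotmod boundary.

End Homology.

(* H_n((A,B,eps);M); differential 0 = 0, so H_0 = C_0 / im (differential 1) *)
Definition sec_homology (k : fieldType) (T : triple k)
    (M : bimodType (tA T) (tA T)) (n : nat) : lmodType k :=
  homology (@differential k T M n.+1) (@differential k T M n).

(* Main.v *)
(* P = rows and Q = columns over A realise the Morita equivalence.

   For the homology, number the entries of an elementary chain as a cyclic word
   x_0 = m, x_1 = a_1, .., x_n = a_n. If sum_q u_q v_q = 1 in A, the operator
   tau_p inserting sum_q u_q (x) v_q between x_p and x_(p+1) satisfies
   delta_p tau_p = delta_p and commutes with the other faces up to reindexing.
   Hence phi = tau_n .. tau_0 is a chain map, and
   sum_i (-1)^i tau_i .. tau_0 s_i, where s_i inserts 1 after x_i, is a homotopy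
   between the identity and phi. Over M_n(A), with u_q = E_(q,1) and
   v_q = E_(1,q), phi maps into the image of the corner inclusion of the complex
   of A (a |-> a E_(1,1)) and is the identity there; so the inclusion is a
   homotopy equivalence, with inverse phi followed by the (1,1) entry. *)

Require Import Defs.
From HB Require Import structures.
From mathcomp Require Import all_boot all_algebra.
From mathcomp Require Import boolp zify.

Set Implicit Arguments.
Unset Strict Implicit.
Unset Printing Implicit Defensive.

Import GRing.Theory.
Local Open Scope ring_scope.

(** * Functoriality of the tensor product of a family *)

Section TensorMap.
Variables (k : fieldType) (I : Type) (V W : I -> lmodType k).
Variable f : forall i, {linear V i -> W i}.

Fact tmap_multilinear : multilinear (fun x => tens (fun i => f i (x i))).
Proof.
move=> i c x y z [zi zE]; apply: (tens_multilinear (i := i)); split.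
  by rewrite zi linearP.
by move=> j /zE[-> ->].
Qed.

Definition tmap : {linear tensor V -> tensor W} := tlift tmap_multilinear.

Lemma tmap_tens x : tmap (tens x) = tens (fun i => f i (x i)).
Proof. exact: tlift_tens. Qed.

End TensorMap.

Arguments tmap : simpl never.

(** * Elementary chains and a uniform formula for the faces *)

Section Chains.
Variables (k : fieldType) (T : triple k) (M : bimodType (tA T) (tA T)).
Local Notation A := (tA T).
Local Notation B := (tB T).
Local Notation eps := (teps T).
Local Notation chain := (chain M).

Lemma array_ext n (x y : array M n) : coef x = coef y -> diag x =1 diag y ->
  (forall p q : 'I_n, (p < q)%N -> upper x p q = upper y p q) -> x = y.
Proof.
move=> c d u; apply: functional_extensionality_dep => -[|i|p q pq].
- exact: c.
- exact: d.
- by rewrite -!upperE u.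
Qed.

(** Entries are indexed by natural numbers, so that the index shifts of faces and degeneracies are
    plain arithmetic. Only the values on the diagonal and strictly above it, within size n,
    matter. *)
Definition elt n (m : M) (a : nat -> A) (b : nat -> nat -> B) : chain n :=
  tens (mkarray m (fun i : 'I_n => a i) (fun p q : 'I_n => b p q)).

Lemma upper_mkarray n m a b (p q : 'I_n) : (p < q)%N ->
  upper (mkarray m a b : array M n) p q = b p q.
Proof. by move=> pq; rewrite upperE. Qed.

Lemma diag_mkarray n m a b (i : 'I_n) :
  diag (mkarray m a b : array M n) i = a i.
Proof. by []. Qed.

Lemma eq_elt n m m' a a' b b' : m = m' -> (forall i, (i < n)%N -> a i = a' i) ->
  (forall p q, (p < q)%N -> (q < n)%N -> b p q = b' p q) ->
  elt n m a b = elt n m' a' b'.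
Proof.
move=> -> ha hb; congr tens; apply: array_ext => //= [i|p q pq].
  exact: ha.
by rewrite !upper_mkarray ?hb.
Qed.

Lemma tens_elt n (x : array M n) : exists a b, tens x = elt n (coef x) a b.
Proof.
exists (fun p => if insub p is Some i then diag x i else 0).
exists (fun p q => if (insub p, insub q) is (Some i, Some j) then upper x i j
                   else 0).
congr tens; apply: array_ext => //= [i|p q pq].
  by rewrite /diag /= valK.
by rewrite upper_mkarray // !valK.
Qed.

(** Elementary chains generate [chain n]; the basic operator identities below are checked on [elt]
    through this lemma. *)
Lemma chain_eq n (W : lmodType k) (f g : {linear chain n -> W}) :
  (forall m a b, f (elt n m a b) = g (elt n m a b)) -> f =1 g.
Proof.
by move=> fg; apply: tensor_eq => x; have [a [b ->]] := tens_elt x.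
Qed.

Lemma elt_sum_coef n (I : finType) (m : I -> M) a b :
  \sum_i elt n (m i) a b = elt n (\sum_i m i) a b.
Proof.
have lin : linear (fun m => elt n m a b).
  move=> c m1 m2; apply: (tens_multilinear (i := Coef n)); split => //.
  by case.
by rewrite (linear_fun_sum lin).
Qed.

Lemma elt_sum_diag n (I : finType) m j (a : nat -> A) (a' : I -> A) b :
  (j < n)%N ->
  \sum_i elt n m (fun p => if p == j then a' i else a p) b =
  elt n m (fun p => if p == j then \sum_i a' i else a p) b.
Proof.
move=> jn.
have lin : linear (fun a' => elt n m (fun p => if p == j then a' else a p) b).
  move=> c a1 a2; apply: (tens_multilinear (i := Diag (Ordinal jn))).
  split=> /=.
    by rewrite eqxx.
  case=> //= i neq; case: eqP => // ij; case: neq; congr Diag.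
  exact: val_inj.
by rewrite (linear_fun_sum lin).
Qed.

(* The formulas below cover all faces at once: face number p merges the
   entries x_p and x_(p+1) of the cyclic word x_0 = m, x_1, .., x_(n+1), so for
   0 < p <= n it is delta_p, and the outer faces only differ in the
   coefficient. *)
Definition fcoef n p (m : M) (a : nat -> A) (b : nat -> nat -> B) : M :=
  if p == 0%N then ract m (a 0%N * eps (\prod_(q < n) b 0%N q.+1))
  else if p == n.+1 then lact (a n * eps (\prod_(q < n) b q n)) m
  else m.

Definition fdiag p (a : nat -> A) (b : nat -> nat -> B) (q : nat) : A :=
  if (q.+1 < p)%N then a q
  else if q.+1 == p then a q * eps (b q q.+1) * a q.+1
  else a q.+1.

Definition fupper p (b : nat -> nat -> B) (q r : nat) : B :=
  if (r.+1 < p)%N then b q r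
  else if r.+1 == p then b q r * b q r.+1
  else if (q.+1 < p)%N then b q r.+1
  else if q.+1 == p then b q r.+1 * b q.+1 r.+1
  else b q.+1 r.+1.

(** For p > 0, [insub p.-1] succeeds exactly when p <= n, so p = n+1 falls through to the last face.
    The choice is between bundled linear maps, hence [nface] inherits linearity. *)
Definition nface_linear n p : {linear chain n.+1 -> chain n} :=
  if p == 0%N then face (@face_firstM k T M n)
  else if insub p.-1 is Some j then face (@face_midM k T M n j)
  else face (@face_lastM k T M n).

Definition nface n p : chain n.+1 -> chain n := nface_linear n p.
HB.instance Definition _ n p := GRing.Linear.on (@nface n p).

Lemma face_elt n n' (F : array M n -> array M n') (FM : array_multilinear F)
    m a b :
  face FM (elt n m a b) =
  tens (F (mkarray m (fun i : 'I_n => a i) (fun p q : 'I_n => b p q))).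
Proof. exact: tlift_tens. Qed.

(** In [fdiag] and [fupper], p = 0 always selects the last branch and p = n+1 the first: these
    delete the first, respectively last, row and column. *)
Lemma nface_elt n p m a b : (p <= n.+1)%N ->
  nface p (elt n.+1 m a b) =
    elt n (fcoef n p m a b) (fdiag p a b) (fupper p b).
Proof.
move=> pn; rewrite /nface /nface_linear; case: eqP => [-> | /eqP p0].
  rewrite face_elt; congr tens; apply: array_ext => /=.
  - rewrite /coef /diag /fcoef /=; congr (ract _ (_ * eps _)).
    by apply: eq_bigr => q _; rewrite upper_mkarray.
  - by move=> i; rewrite /diag /fdiag.
  - by move=> q r qr; rewrite !upper_mkarray //= /fupper.
have eps_le (i : 'I_n) : lift ord_max i = i :> nat := lift_max i.
case: insubP => [j _ /= jp|].
  have jn := ltn_ord j.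
  have -> : p = j.+1 by lia.
  rewrite face_elt; congr tens; apply: array_ext => /=.
  - by rewrite /coef /fcoef /= eqSS ltn_eqF.
  - move=> i; rewrite /diag /fdiag /= ltnS eqSS.
    by rewrite !diag_mkarray upper_mkarray !eps_le lift0.
  - move=> q r qr; rewrite !upper_mkarray ?eps_le ?lift0 //; lia.
rewrite -leqNgt => np; have -> : p = n.+1 by lia.
rewrite face_elt; congr tens; apply: array_ext => /=.
- rewrite /coef /diag /fcoef /= eqxx; congr (lact (_ * eps _) _).
  by apply: eq_bigr => q _; rewrite upper_mkarray eps_le /=.
- by move=> i; rewrite !diag_mkarray /fdiag ltnS ltn_ord eps_le.
- by move=> q r qr; rewrite !upper_mkarray ?eps_le // /fupper ltnS ltn_ord.
Qed.

Lemma differential_nface n (x : chain n.+1) :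
  differential x = \sum_(p < n.+2) (-1) ^+ p *: nface p x.
Proof.
rewrite big_ord_recl big_ord_recr expr0 scale1r /= addrA.
congr (_ + _ + _).
- apply: eq_bigr => j _; rewrite /nface /nface_linear /= /bump /= add1n.
  by rewrite valK.
- rewrite /nface /nface_linear /bump add1n /=.
  by case: insubP => // j; rewrite ltnn.
Qed.

End Chains.

Arguments nface : simpl never.

(** * Chain maps induced slot by slot *)

Section SlotMap.
Variables (k : fieldType) (T T' : triple k).
Variables (M : bimodType (tA T) (tA T)) (M' : bimodType (tA T') (tA T')).
Variables (fM : {linear M -> M'}) (fA : nat -> {linear tA T -> tA T'}).
Variable fB : {linear tB T -> tB T'}.

(** The map on a diagonal entry may vary with its position, as gap multiplication requires; the
    corner map takes a constant family. *)
Definition slot_map n (s : slot n) :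
    {linear slot_mod M s -> slot_mod M' s} :=
  match s return {linear slot_mod M s -> slot_mod M' s} with
  | Coef => fM | Diag i => fA i | Upper _ _ _ => fB
  end.

Definition smap n : chain M n -> chain M' n := tmap (@slot_map n).
HB.instance Definition _ n := GRing.Linear.on (@smap n).

Lemma smap_elt n m a b : smap (n := n) (elt n m a b) =
  elt n (fM m) (fun i => fA i (a i)) (fun p q => fB (b p q)).
Proof.
rewrite /smap {1}/elt tmap_tens; congr tens.
by apply: functional_extensionality_dep => -[].
Qed.

End SlotMap.

Arguments smap : simpl never.

(** * Multiplication at the gaps of the cyclic word *)

Section GapMultiplication.
Variables (k : fieldType) (T : triple k) (M : bimodType (tA T) (tA T)).
Local Notation A := (tA T).
Local Notation B := (tB T).
Local Notation eps := (teps T).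
Local Notation chain := (chain M).

Definition sandwich (v u a : A) : A := v * a * u.
Fact sandwich_linear v u : linear (sandwich v u).
Proof.
by move=> c a b; rewrite /sandwich mulrDr mulrDl -scalerAr -scalerAl.
Qed.
HB.instance Definition _ v u :=
  GRing.isLinear.Build k A A _ (sandwich v u) (sandwich_linear v u).

Definition bsandwich (v u : A) (m : M) : M := lact v (ract m u).
Fact bsandwich_linear v u : linear (bsandwich v u).
Proof. by move=> c a b; rewrite /bsandwich ract_linear lact_linear. Qed.
HB.instance Definition _ v u :=
  GRing.isLinear.Build k M M _ (bsandwich v u) (bsandwich_linear v u).

(* Gap p of the cyclic word x_0, .., x_n lies between x_p and x_(p+1); the
   operator multiplies by u p on the left-hand side of gap p and by v p on its
   right-hand side. *)
Definition gapmul n (u v : nat -> A) : chain n -> chain n :=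
  smap (bsandwich (v n) (u 0%N)) (fun i => sandwich (v i) (u i.+1)) idfun
    (n := n).
HB.instance Definition _ n u v := GRing.Linear.on (@gapmul n u v).

Arguments gapmul : simpl never.

Lemma gapmul_elt n u v m a b : gapmul u v (elt n m a b) =
  elt n (lact (v n) (ract m (u 0%N))) (fun i => v i * a i * u i.+1) b.
Proof. exact: smap_elt. Qed.

Lemma eq_gapmul n u v u' v' (x : chain n) :
  (forall p, (p <= n)%N -> u p = u' p) ->
  (forall p, (p <= n)%N -> v p = v' p) -> gapmul u v x = gapmul u' v' x.
Proof.
move=> eu ev; apply: chain_eq x => m a b /=; rewrite !gapmul_elt.
by apply: eq_elt => // [|i ni]; rewrite eu ?ev // ltnW.
Qed.

Lemma gapmul1 n (x : chain n) : gapmul (fun=> 1) (fun=> 1) x = x.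
Proof.
have E m a b : gapmul (fun=> 1) (fun=> 1) (elt n m a b) = elt n m a b.
  rewrite gapmul_elt ract1 lact1; apply: eq_elt => // i _.
  by rewrite mul1r mulr1.
exact: (chain_eq (f := gapmul _ _) (g := @idfun (chain n))) x.
Qed.

(** The [u] factors accumulate on the right of an entry and the [v] factors on its left, so the
    inner operator stays next to the entry. *)
Lemma gapmul_comp n u v u' v' (x : chain n) :
  gapmul u v (gapmul u' v' x) =
  gapmul (fun p => u' p * u p) (fun p => v p * v' p) x.
Proof.
apply: (chain_eq (f := gapmul u v \o gapmul u' v')
                 (g := gapmul _ _)) x => m a b /=.
rewrite !gapmul_elt; apply: eq_elt => // [|i _]; last by rewrite !mulrA.
by rewrite !lractA lactA ractA.
Qed.

Lemma gapmul0 n p (u v : nat -> A) (x : chain n) :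
  (p <= n)%N -> u p = 0 -> gapmul u v x = 0.
Proof.
move=> pn up; have E m a b : gapmul u v (elt n m a b : chain n) = 0.
  rewrite gapmul_elt; case: p pn up => [|p] pn up.
    rewrite up (linear_fun0 (ract_linearr _)) (linear_fun0 (lact_linear _)).
    set a' := fun i => _.
    (* Zero is written as an empty sum, so that additivity in the slot gives the vanishing. *)
    by have := elt_sum_coef n (fun _ : 'I_0 => 0 : M) a' b; rewrite !big_ord0.
  transitivity (\sum_(i < 0) elt n (lact (v n) (ract m (u 0)))
    (fun q => if q == p then 0 else v q * a q * u q.+1) b); last first.
    by rewrite big_ord0.
  rewrite elt_sum_diag // big_ord0; apply: eq_elt => // q _.
  by case: eqP => [->|//]; rewrite up mulr0.
exact: (chain_eq (f := gapmul u v) (g := \0)) x.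
Qed.

(** Face p closes gap p, so the factors there must be trivial, and [bump p] gives the old numbers of
    the surviving gaps. For p = 0, centrality of [eps] lets [u 1] pass the product of the first
    row. *)
Lemma nface_gapmul n p u v (x : chain n.+1) :
  (p <= n.+1)%N -> u p = 1 -> v p = 1 ->
  nface p (gapmul u v x) =
  gapmul (u \o bump p) (v \o bump p) (nface p x).
Proof.
move=> pn up vp.
apply: (chain_eq (f := nface p \o gapmul u v)
                 (g := gapmul _ _ \o nface p)) x => m a b /=.
rewrite gapmul_elt !nface_elt // gapmul_elt /=; apply: eq_elt => // [|q qn].
  rewrite /fcoef; case: (eqVneq p 0%N) up vp => [-> /= -> ->|p0 up vp].
    rewrite ract1 mul1r lractA ractA; congr (lact _ (ract _ _)).
    by rewrite -mulrA -teps_central mulrA.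
  have -> : bump p 0 = 0%N by rewrite /bump; lia.
  case: eqP up vp => [-> -> ->|pn' up vp].
    rewrite lact1 mulr1 lractA lactA -!mulrA /bump; congr (lact _ _).
    by congr (v _ * _); lia.
  by have -> : bump p n = n.+1 by rewrite /bump; lia.
rewrite /fdiag; case: ifP => [qp|qp].
  by have [-> ->] : bump p q = q /\ bump p q.+1 = q.+1 by rewrite /bump; lia.
case: eqP => [qp'|qp'].
  have [-> ->] : bump p q = q /\ bump p q.+1 = q.+2 by rewrite /bump; lia.
  by rewrite qp' up vp mulr1 mul1r !mulrA.
by have [-> ->] : bump p q = q.+1 /\ bump p q.+1 = q.+2 by rewrite /bump; lia.
Qed.

End GapMultiplication.

(** * Degeneracies and simplicial identities *)

Section Degeneracies.
Variables (k : fieldType) (T : triple k) (M : bimodType (tA T) (tA T)).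
Local Notation A := (tA T).
Local Notation B := (tB T).
Local Notation eps := (teps T).
Local Notation chain := (chain M).
Local Notation array := (array M).

(** The new row and column consist of 1. Diagonal positions count from 0, so index i is the entry
    x_(i+1) of the cyclic word: the insertion is right after x_i. *)
Definition array_insert n (i : 'I_n.+1) (x : array n) : array n.+1 :=
  mkarray (coef x)
    (fun p => if unlift i p is Some p' then diag x p' else 1)
    (fun p q => if (unlift i p, unlift i q) is (Some p', Some q')
                then upper x p' q' else 1).

Lemma array_insertM n (i : 'I_n.+1) : array_multilinear (array_insert i).
Proof.
case=> [|j|p q pq] c x y z.
- move=> /lincomb_coef[zE [dx dy] ux uy]; exists (Coef _).
  split=> //= -[|j|p q pq] //= _; first by rewrite dx dy.
  by rewrite ux uy.
- move=> /lincomb_diag[zE [cx cy] d ux uy]; exists (Diag (lift i j)).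
  split=> /=; first by rewrite liftK.
  case=> [|l|p q pq] /= neq; [by rewrite cx cy| |by rewrite ux uy].
  case: unliftP neq => //= l' -> neq; apply: d.
  by apply/eqP => ll; case: neq; rewrite ll.
- move=> /lincomb_upper[zE [cx cy] dx dy u].
  have pq' : (lift i p < lift i q)%N by rewrite /= /bump; lia.
  exists (Upper pq'); split=> /=; first by rewrite !liftK.
  case=> [|l|r s rs] /= neq; [by rewrite cx cy|by rewrite dx dy|].
  case: unliftP neq => //= r' rE neq.
  case: unliftP neq => //= s' sE neq.
  apply: u; case: eqP => //= /val_inj rp; case: eqP => //= /val_inj sq.
  move: rs neq; rewrite rE sE rp sq => rs; case.
  by rewrite (bool_irrelevance rs pq').
Qed.

Definition degen n i : chain n -> chain n.+1 :=
  face (array_insertM (inord i : 'I_n.+1)).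
HB.instance Definition _ n i := GRing.Linear.on (@degen n i).
Arguments degen : simpl never.

Definition ins_diag i (a : nat -> A) p : A :=
  if p == i then 1 else a (unbump i p).

Definition ins_upper i (b : nat -> nat -> B) p q : B :=
  if (p == i) || (q == i) then 1 else b (unbump i p) (unbump i q).

Lemma degen_elt n i m a b : (i <= n)%N ->
  degen i (elt n m a b) = elt n.+1 m (ins_diag i a) (ins_upper i b).
Proof.
move=> ni; rewrite /degen face_elt; congr tens.
have iE : (inord i : 'I_n.+1) = i :> nat by rewrite inordK.
apply: array_ext => //= [p|p q pq].
  rewrite !diag_mkarray /ins_diag; case: unliftP => [p' ->|->].
    by rewrite /= iE eq_sym (negPf (neq_bump _ _)) bumpK.
  by rewrite iE eqxx.
rewrite !upper_mkarray // /ins_upper.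
case: unliftP pq => [p' ->|->]; last first.
  by rewrite iE eqxx.
case: unliftP => [q' ->|->] pq; last by rewrite iE eqxx orbT.
have pq' : (p' < q')%N by move: pq; rewrite /= /bump; lia.
rewrite upper_mkarray //= iE !bumpK.
by rewrite ![_ == i]eq_sym !(negPf (neq_bump _ _)).
Qed.


Ltac if_cases := repeat match goal with
  |- context [if ?c then _ else _] =>
    let H := fresh in case H : c; try (exfalso; lia)
  end; try rewrite !(mul1r, mulr1, rmorph1).

(** The row or column products in the outer faces do not see the inserted entry, which is 1. *)
Lemma prod_unbump (R : comPzRingType) n i (F : nat -> R) : (i <= n)%N ->
  \prod_(q < n.+1) (if q == i :> nat then 1 else F (unbump i q)) =
  \prod_(q < n) F q.
Proof.
move=> ni; have iE : (inord i : 'I_n.+1) = i :> nat by rewrite inordK.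
rewrite (bigD1_ord (inord i : 'I_n.+1)) //= iE eqxx mul1r.
apply: eq_bigr => q _.
by rewrite bumpK eq_sym (negPf (neq_bump _ _)).
Qed.

(** Merging the inserted 1 with its left or right neighbour undoes the insertion; for i = p = 0 and
    for i = n, p = n+1 that neighbour is the coefficient. *)
Lemma nface_degen_id n p i (x : chain n) : (i <= n)%N ->
  (p == i) || (p == i.+1) -> nface p (degen i x) = x.
Proof.
move=> ni pE; have E m a b : nface p (degen i (elt n m a b)) = elt n m a b.
  rewrite degen_elt // nface_elt; last by lia.
  apply: eq_elt => [|q qn|q r qr rn].
  - rewrite /fcoef; case: eqP => [p0|p0].
      rewrite big1 ?rmorph1 ?mulr1 => [|q _]; last first.
        by rewrite /ins_upper; if_cases.
      by rewrite /ins_diag; if_cases; rewrite ract1.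
    case: eqP => // pn; rewrite big1 ?rmorph1 ?mulr1 => [|q _]; last first.
      by rewrite /ins_upper; if_cases.
    by rewrite /ins_diag; if_cases; rewrite lact1.
  - by rewrite /fdiag /ins_diag /ins_upper /unbump; if_cases; congr (a _);
      lia.
  - by rewrite /fupper /ins_upper /unbump; if_cases; congr (b _ _);
      rewrite /unbump; lia.
exact: (chain_eq (f := nface p \o degen i) (g := @idfun (chain n))) x.
Qed.

Lemma nface_degen_lt n p i (x : chain n.+1) : (i <= n.+1)%N -> (p < i)%N ->
  nface p (degen i x) = degen i.-1 (nface p x).
Proof.
move=> ni pi; apply: (chain_eq (f := nface p \o degen i)
  (g := degen i.-1 \o nface p)) x => m a b /=.
rewrite degen_elt // !nface_elt ?degen_elt; try by lia.
apply: eq_elt => [|q qn|q r qr rn].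
- rewrite /fcoef; case: eqP => [p0|p0].
    have -> : ins_diag i a 0 = a 0%N by rewrite /ins_diag; if_cases.
    (* The row product runs over columns q+1, so the inserted column i is its factor number i-1. *)
    rewrite -(@prod_unbump _ n i.-1 (fun q => b 0%N q.+1)) //; last by lia.
    congr (ract _ (_ * eps _)); apply: eq_bigr => q _.
    by rewrite /ins_upper; if_cases => //; congr (b _ _); rewrite /unbump; lia.
  by if_cases.
- rewrite /fdiag /ins_diag /ins_upper /unbump; if_cases;
    first [by []|congr (a _); lia|congr (a _ * eps (b _ _) * a _); lia].
- rewrite /fupper /ins_upper /unbump; if_cases;
    first [by []|congr (b _ _); lia|congr (b _ _ * b _ _); lia].
Qed.

Lemma nface_degen_gt n p i (x : chain n.+1) : (p <= n.+2)%N -> (i.+1 < p)%N ->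
  nface p (degen i x) = degen i (nface p.-1 x).
Proof.
move=> pn pi; apply: (chain_eq (f := nface p \o degen i)
  (g := degen i \o nface p.-1)) x => m a b /=.
rewrite degen_elt ?nface_elt ?degen_elt; try by lia.
apply: eq_elt => [|q qn|q r qr rn].
- rewrite /fcoef; if_cases => //.
  have -> : ins_diag i a n.+1 = a n by rewrite /ins_diag; if_cases;
    rewrite /unbump; congr (a _); lia.
  rewrite -(@prod_unbump _ n i (b^~ n)) //; last by lia.
  congr (lact (_ * eps _) _); apply: eq_bigr => q _.
  by rewrite /ins_upper; if_cases => //; congr (b _ _); rewrite /unbump; lia.
- rewrite /fdiag /ins_diag /ins_upper /unbump; if_cases;
    first [by []|congr (a _); lia|congr (a _ * eps (b _ _) * a _); lia].
- rewrite /fupper /ins_upper /unbump; if_cases;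
    first [by []|congr (b _ _); lia|congr (b _ _ * b _ _); lia].
Qed.

End Degeneracies.

(** * The sign bookkeeping of a simplicial homotopy *)

Section AlternatingSums.
Variables (k : fieldType) (V : lmodType k).
Local Notation sg p := ((-1 : k) ^+ p).

(** With F p i = d_p h_i and G i p = h_i d_p, this is the identity d h = d_0 h_0 - d_(n+1) h_n - h
    d: terms away from the diagonal recombine into h d, and those with p = i or p = i+1
    telescope. *)
Lemma prism_sum n (F G : nat -> nat -> V) :
  (forall p i, (i <= n)%N -> (p < i)%N -> F p i = G i.-1 p) ->
  (forall p i, (p <= n.+1)%N -> (i.+1 < p)%N -> F p i = G i p.-1) ->
  (forall i, (i < n)%N -> F i.+1 i = F i.+1 i.+1) ->
  \sum_(i < n.+1) \sum_(p < n.+2) sg (i + p) *: F p i =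
  F 0%N 0%N - F n.+1 n - \sum_(i < n) \sum_(p < n.+1) sg (i + p) *: G i p.
Proof.
move=> Flt Fgt Feq.
(* [D] extends the diagonal terms d_i h_i by d_(n+1) h_n at i = n+1, so that every row contributes D
   i - D (i+1). [L] and [U] collect the terms with p < i and p > i+1. *)
pose D i := if (i <= n)%N then F i i else F i i.-1.
pose L i := \sum_(0 <= p < i) sg (i + p) *: G i.-1 p.
pose U i := \sum_(i.+2 <= p < n.+2) sg (i + p) *: G i p.-1.
have row (i : 'I_n.+1) :
    \sum_(p < n.+2) sg (i + p) *: F p i = (L i + U i) + (D i - D i.+1).
  have ni : (i <= n)%N := ltn_ord i.
  rewrite -(big_mkord xpredT (fun p => sg (i + p) *: F p i)).
  rewrite (big_cat_nat (n := i)) //=; last by lia.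
  rewrite (big_ltn (m := i)) ?(big_ltn (m := i.+1)); [|lia..].
  rewrite addnS !exprS addnn -mul2n exprM sqrrN !expr1n mulr1 scale1r scaleN1r.
  have -> : D i = F i i by rewrite /D ni.
  have -> : D i.+1 = F i.+1 i.
    by rewrite /D; case: ifP => // /Feq ->.
  have -> : \sum_(0 <= p < i) sg (i + p) *: F p i = L i.
    by apply: eq_big_nat => p /andP[_ pi]; rewrite Flt.
  have -> : \sum_(i.+2 <= p < n.+2) sg (i + p) *: F p i = U i.
    by apply: eq_big_nat => p /andP[ip pn]; rewrite Fgt.
  by rewrite addrA [RHS]addrACA [U i + _]addrC.
rewrite (eq_bigr _ (fun i _ => row i)) big_split /= addrC; congr (_ + _).
  rewrite -(big_mkord xpredT (fun i => D i - D i.+1)).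
  rewrite (telescope_sumr_eq (fun i => - D i)) // => [|i _]; last first.
    by rewrite opprK addrC.
  by rewrite opprK addrC /D ltnn.
(* [L] of i+1 and [U] of i together make up row i of the double sum of [G], with opposite sign; the
   two leftover terms [L 0] and [U n] are empty. *)
rewrite big_split /= big_ord_recl [X in _ + X]big_ord_recr /=.
have -> : L 0%N = 0 by rewrite /L big_geq.
have -> : U n = 0 by rewrite /U big_geq.
rewrite add0r addr0 -big_split -sumrN; apply: eq_bigr => i _ /=.
rewrite /bump add1n /L /U /= big_add1 /=.
rewrite -(big_mkord xpredT (fun p => sg (i + p) *: G i p)).
have ni := ltn_ord i.
rewrite [in RHS](big_cat_nat (n := i.+1)) //=; last by lia.
rewrite opprD -!sumrN.
congr (_ + _).
  by apply: eq_big_nat => p _; rewrite addSn exprS mulN1r scaleNr.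
by apply: eq_big_nat => p _; rewrite addnS exprS mulN1r scaleNr.
Qed.
End AlternatingSums.

(** * Filling gaps with a partition of 1, and the homotopy *)

Section Contraction.
Variables (k : fieldType) (T : triple k) (M : bimodType (tA T) (tA T)).
Local Notation A := (tA T).
Local Notation eps := (teps T).
Local Notation chain := (chain M).
Variables (I : finType) (u v : I -> A).

Definition at_gap (p : nat) (a : A) (r : nat) : A := if r == p then a else 1.

Definition tau n p (x : chain n) : chain n :=
  \sum_i gapmul (at_gap p (u i)) (at_gap p (v i)) x.

Fact tau_linear n p : linear (@tau n p).
Proof.
move=> c x y; rewrite /tau scaler_sumr -big_split.
by apply: eq_bigr => i _; rewrite linearP.
Qed.
HB.instance Definition _ n p :=
  GRing.isLinear.Build k (chain n) (chain n) _ (@tau n p) (@tau_linear n p).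

(** Gaps 0 to r-1 are filled; on C_n the case r = n+1 fills all of them and is the map phi. *)
Fixpoint taus n r (x : chain n) : chain n :=
  if r is r'.+1 then tau r' (taus r' x) else x.

Fact taus_linear n r : linear (@taus n r).
Proof. by elim: r => //= r IH c x y; rewrite IH linearP. Qed.
HB.instance Definition _ n r :=
  GRing.isLinear.Build k (chain n) (chain n) _ (@taus n r) (@taus_linear n r).

(** A filled gap carries u_i on one side and v_i on the other, and both absorb e. With e = E_(1,1)
    this places the image of phi in the corner. *)
Lemma gapmul_taus n (e : A) (x : chain n) r :
  e * e = e -> (forall i, u i * e = u i) -> (forall i, e * v i = v i) ->
  let E p := if (p < r)%N then e else 1 in
  gapmul E E (taus r x) = taus r x.
Proof.
move=> ee ue ev; elim: r => [|r IH] /=; first exact: gapmul1.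
(* The induction hypothesis puts e into all gaps below r on both sides, where e * e = e applies;
   absorption is then needed at gap r alone. *)
rewrite -IH /tau linear_sum; apply: eq_bigr => i _ /=.
rewrite !gapmul_comp; apply: eq_gapmul => p _; rewrite /at_gap ltnS;
  by case: (ltngtP p r); rewrite ?(mul1r, mulr1).
Qed.

(** Face p removes gap p: earlier gaps keep their numbers, later ones drop by one. *)
Lemma nface_tau_lt n p r (x : chain n.+1) : (p <= n.+1)%N -> (r < p)%N ->
  nface p (tau r x) = tau r (nface p x).
Proof.
move=> pn rp; rewrite /tau linear_sum; apply: eq_bigr => i _.
rewrite /= nface_gapmul // /at_gap; try by rewrite gtn_eqF.
by apply: eq_gapmul => q _ /=; congr (if _ then _ else _); rewrite /bump; lia.
Qed.

Lemma nface_tau_gt n p r (x : chain n.+1) : (p <= n.+1)%N -> (p < r)%N ->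
  nface p (tau r x) = tau r.-1 (nface p x).
Proof.
move=> pn rp; rewrite /tau linear_sum; apply: eq_bigr => i _.
rewrite /= nface_gapmul // /at_gap; try by rewrite ltn_eqF.
by apply: eq_gapmul => q _ /=; congr (if _ then _ else _); rewrite /bump; lia.
Qed.

Hypothesis uv1 : \sum_i u i * v i = 1.

Lemma sum_insert (a b : A) : \sum_i a * u i * (v i * b) = a * b.
Proof.
under eq_bigr do rewrite mulrA -(mulrA a).
by rewrite -mulr_suml -mulr_sumr uv1 mulr1.
Qed.

(** Face p brings u_i and v_i of gap p together, where they sum to 1. The product forms on the right
    of the coefficient, on its left, or in diagonal entry p-1. *)
Lemma nface_tau_eq n p (x : chain n.+1) : (p <= n.+1)%N ->
  nface p (tau p x) = nface p x.
Proof.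
move=> pn.
apply: (chain_eq (f := nface p \o tau p) (g := nface p)) x => m a b /=.
rewrite /tau linear_sum /=.
under eq_bigr do rewrite gapmul_elt nface_elt //.
rewrite nface_elt //.
have [p0|p0] := eqVneq p 0%N.
  transitivity (\sum_i elt n (ract m (u i * (v i * (a 0%N *
    eps (\prod_(q < n) b 0%N q.+1))))) (fdiag p a b) (fupper p b)).
    apply: eq_bigr => i _; apply: eq_elt => // [|q qn].
      by rewrite /fcoef p0 /at_gap /= mulr1 lact1 ractA !mulrA.
    by rewrite p0 /fdiag /= /at_gap /= mul1r mulr1.
  rewrite elt_sum_coef -(linear_fun_sum (ract_linearr m)) /fcoef p0 /=.
  congr (elt _ (ract _ _) _ _).
  by rewrite -[RHS]mul1r -[RHS]sum_insert; apply: eq_bigr => i _; rewrite mul1r.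
have [pn1|pn1] := eqVneq p n.+1.
  transitivity (\sum_i elt n (lact (a n * eps (\prod_(q < n) b q n) *
    u i * (v i * 1)) m) (fdiag p a b) (fupper p b)).
    apply: eq_bigr => i _; apply: eq_elt => // [|q qn].
      rewrite /fcoef pn1 /= eqxx /at_gap eqxx ltn_eqF // ract1 lactA mul1r.
      by rewrite mulr1 -teps_central mulrA (teps_central _ (a n)).
    by rewrite pn1 /fdiag ltnS qn /at_gap !ltn_eqF ?mul1r ?mulr1 //; lia.
  rewrite elt_sum_coef -(linear_fun_sum (lact_linearl m)) sum_insert mulr1.
  by rewrite /fcoef pn1 eqxx.
(* Only the merged entry depends on i; isolating it makes additivity in that slot applicable. *)
transitivity (\sum_i elt n m (fun q => if q == p.-1 then
    a p.-1 * u i * (v i * (eps (b p.-1 p) * a p)) else fdiag p a b q)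
    (fupper p b)).
  apply: eq_bigr => i _; apply: eq_elt => // [|q qn].
    rewrite /fcoef (negPf p0) (negPf pn1) /at_gap gtn_eqF; last by lia.
    by rewrite eq_sym (negPf p0) lact1 ract1.
  rewrite /fdiag /at_gap; case: (eqVneq q p.-1) => [->|qp].
    have -> : p.-1.+1 = p by lia.
    have -> : (p.-1 == p) = false by lia.
    have -> : (p.+1 == p) = false by lia.
    rewrite ltnn eqxx.
    rewrite mul1r mulr1 -!mulrA; congr (_ * (_ * _)).
    by rewrite !mulrA teps_central.
  case: ifP => qp'; first by rewrite !ltn_eqF ?mul1r ?mulr1 //; lia.
  have -> : (q.+1 == p) = false by lia.
  by rewrite !gtn_eqF ?mul1r ?mulr1 //; lia.
rewrite elt_sum_diag; last by lia.
apply: eq_elt => // [|q qn].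
  by rewrite /fcoef (negPf p0) (negPf pn1).
case: eqP => [->|//]; rewrite sum_insert /fdiag.
have -> : p.-1.+1 = p by lia.
by rewrite ltnn eqxx mulrA.
Qed.

Lemma nface_taus_le n p r (x : chain n.+1) : (p <= n.+1)%N -> (r <= p)%N ->
  nface p (taus r x) = taus r (nface p x).
Proof.
move=> pn; elim: r => //= r IH rp.
by rewrite nface_tau_lt // IH // ltnW.
Qed.

(** One filling is lost: face p absorbs tau_p, and the fillings of later gaps are renumbered. *)
Lemma nface_taus_gt n p r (x : chain n.+1) : (p <= n.+1)%N -> (p < r)%N ->
  nface p (taus r x) = taus r.-1 (nface p x).
Proof.
move=> pn; elim: r => //= r IH; rewrite ltnS leq_eqVlt => /orP[/eqP <-|pr].
  by rewrite nface_tau_eq // nface_taus_le.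
by rewrite nface_tau_gt // IH //; case: r pr {IH}.
Qed.

Lemma differential_taus n (x : chain n.+1) :
  differential (taus n.+2 x) = taus n.+1 (differential x).
Proof.
rewrite !differential_nface linear_sum; apply: eq_bigr => p _.
by rewrite linearZ_LR nface_taus_gt // -ltnS.
Qed.

Definition prism n i (x : chain n) : chain n.+1 := taus i.+1 (degen i x).
HB.instance Definition _ n i :=
  GRing.Linear.copy (@prism n i) (@taus n.+1 i.+1 \o @degen k T M n i).
Arguments prism : simpl never.

Definition homotopy n (x : chain n) : chain n.+1 :=
  \sum_(i < n.+1) (-1) ^+ i *: prism i x.

Lemma differential_homotopy n (x : chain n) : differential x = 0 ->
  differential (homotopy x) = x - taus n.+1 x.
Proof.
(* [G] is h_i d_p; there is no face on C_0, so in degree 0 it is set to 0. *)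
move=> dx; pose G i p : chain n := match n return chain n -> chain n with
  | 0 => fun=> 0
  | n'.+1 => fun x => prism i (nface p x)
  end x.
have -> : differential (homotopy x) =
    \sum_(i < n.+1) \sum_(p < n.+2) (-1) ^+ (i + p) *: nface p (prism i x).
  rewrite /homotopy linear_sum; apply: eq_bigr => i _.
  transitivity ((-1) ^+ i *: differential (prism i x)).
    exact: linearZ_LR.
  rewrite differential_nface scaler_sumr; apply: eq_bigr => p _.
  by rewrite scalerA exprD.
rewrite (prism_sum (F := fun p i => nface p (prism i x)) (G := G)).
(* The end terms: d_0 h_0 is the identity and d_(n+1) h_n is phi. What remains is the homotopy
   applied to the differential of x, which is 0. *)
- rewrite /prism nface_taus_gt // nface_degen_id // nface_taus_le //.
  rewrite nface_degen_id ?eqxx ?orbT // [taus _.-1 _]/=.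
  suff -> : \sum_(i < n) \sum_(p < n.+1) (-1) ^+ (i + p) *: G i p = 0.
    by rewrite subr0.
  rewrite /G; case: n x dx {G} => [|n] x dx; first by rewrite big_ord0.
  apply: big1 => i _; transitivity ((-1) ^+ i *: prism i (differential x)).
    rewrite differential_nface (linear_sum (@prism n i)) scaler_sumr.
    by apply: eq_bigr => p _; rewrite linearZ_LR scalerA exprD.
  by rewrite dx linear0 scaler0.
- move=> p i ni pi; rewrite /G; case: n x ni {dx G} => [|n] x ni; first by lia.
  rewrite /prism nface_taus_gt //=; [|lia..].
  by rewrite nface_degen_lt //; case: i ni pi.
- move=> p i pn pi; rewrite /G; case: n x pn {dx G} => [|n] x pn; first by lia.
  by rewrite /prism nface_taus_le ?nface_degen_gt //; lia.
(* Both sides equal [taus i.+1 x]: gap i+1 is unfilled in h_i, while in h_(i+1) its filling is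
   absorbed by the face. *)
- move=> i ni.
  rewrite /prism nface_taus_le ?nface_degen_id ?eqxx ?orbT //; [|lia..].
  rewrite nface_taus_gt ?nface_degen_id ?eqxx ?orbT //; lia.
Qed.

End Contraction.

(** * Induced maps and isomorphisms on homology *)

Section HomologyMap.
Variables (k : fieldType) (U V W U' V' W' : lmodType k).
Variables (d1 : {linear U -> V}) (d0 : {linear V -> W}).
Variables (d1' : {linear U' -> V'}) (d0' : {linear V' -> W'}).
Variable f : {linear V -> V'}.
Hypothesis fC : forall v, d0 v = 0 -> d0' (f v) = 0.
Hypothesis fB : forall u, exists u', d1' u' = f (d1 u).

Fact cycle_map_subproof (z : cycles d0) : f (cycle_val z) \in ker_pred d0'.
Proof. by apply/eqP/fC/eqP; apply: cycle_valP. Qed.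

Definition cycle_map (z : cycles d0) : cycles d0' :=
  Cycle (cycle_map_subproof z).

Fact cycle_map_linear : linear cycle_map.
Proof. by move=> c x y; apply: val_inj; rewrite /= linearP. Qed.
HB.instance Definition _ := GRing.isLinear.Build k (cycles d0) (cycles d0') _
  cycle_map cycle_map_linear.

Fact homology_map_subproof (z : cycles d0) : boundary d1 z ->
  (qproj (@boundary _ _ _ _ d1' d0') \o cycle_map) z = 0.
Proof.
case=> u uz; apply: qproj_gen; have [u' u'E] := fB u.
by exists u'; rewrite u'E uz.
Qed.

Definition homology_map : {linear homology d1 d0 -> homology d1' d0'} :=
  qlift homology_map_subproof.

Lemma homology_map_qproj z :
  homology_map (qproj (@boundary _ _ _ _ d1 d0) z) =
  qproj (@boundary _ _ _ _ d1' d0') (cycle_map z).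
Proof. exact: qlift_qproj. Qed.

End HomologyMap.

(** One direction is an exact inverse; the other is an inverse up to boundaries on cycles, which is
    all that the quotient sees. *)
Lemma homology_iso (k : fieldType) (U V W U' V' W' : lmodType k)
    (d1 : {linear U -> V}) (d0 : {linear V -> W})
    (d1' : {linear U' -> V'}) (d0' : {linear V' -> W'})
    (f : {linear V -> V'}) (g : {linear V' -> V}) :
  (forall v, d0 v = 0 -> d0' (f v) = 0) ->
  (forall u, exists u', d1' u' = f (d1 u)) ->
  (forall v, d0' v = 0 -> d0 (g v) = 0) ->
  (forall u', exists u, d1 u = g (d1' u')) ->
  (forall v, g (f v) = v) ->
  (forall v, d0' v = 0 -> exists u, d1' u = v - f (g v)) ->
  lmod_iso (homology d1 d0) (homology d1' d0').
Proof.
move=> fC fB gC gB gf fg; exists (homology_map fC fB).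
exists (homology_map gC gB) => x; elim/quotmod_ind: x => z.
  rewrite !homology_map_qproj; congr (qproj _ _); apply: val_inj; exact: gf.
rewrite !homology_map_qproj; apply/esym/eqP.
rewrite -subr_eq0 -linearB; apply/eqP/qproj_gen.
have [u uE] := fg (cycle_val z) (eqP (cycle_valP z)).
by exists u; rewrite uE.
Qed.

(** * When a slotwise map commutes with the differential *)

Section SlotMapFaces.
Variables (k : fieldType) (T T' : triple k).
Variables (M : bimodType (tA T) (tA T)) (M' : bimodType (tA T') (tA T')).
Variables (fM : {linear M -> M'}) (fA : {linear tA T -> tA T'}).
Variable fB : {lrmorphism tB T -> tB T'}.
Hypothesis fAM : forall a b, fA (a * b) = fA a * fA b.
Hypothesis fAeps : forall a b, fA (a * teps T b) = fA a * teps T' (fB b).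
Hypothesis fMl : forall a m, fM (lact a m) = lact (fA a) (fM m).
Hypothesis fMr : forall m a, fM (ract m a) = ract (fM m) (fA a).

Local Notation phi := (smap fM (fun=> fA) fB).

(** Faces use only products, actions and multiplication by [eps]. Preservation of 1 is not asked of
    [fA], because the corner inclusion is in general not unital; for the same reason [fAeps] is
    stated for products a * eps b. *)
Lemma nface_smap n p (x : chain M n.+1) : (p <= n.+1)%N ->
  nface p (phi x) = phi (nface p x).
Proof.
move=> pn; apply: (chain_eq (f := nface p \o @phi n.+1)
  (g := @phi n \o nface p)) x => m a b /=.
rewrite nface_elt // !smap_elt nface_elt //.
apply: eq_elt => [|q qn|q r qr rn].
- by rewrite /fcoef; do 2?case: ifP => // _;
    rewrite -rmorph_prod -fAeps -?fMl -?fMr.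
- by rewrite /fdiag; do 2?case: ifP => // _; rewrite fAM fAeps.
- by rewrite /fupper; do 4?case: ifP => // _; rewrite rmorphM.
Qed.

Lemma differential_smap n (x : chain M n) :
  differential (phi x) = phi (differential x).
Proof.
case: n x => [|n] x; first by rewrite /= linear0.
rewrite !differential_nface linear_sum; apply: eq_bigr => p _.
by rewrite linearZ_LR /= nface_smap // -ltnS.
Qed.

End SlotMapFaces.

(** * Corner inclusion, (1,1) entry and scalar matrices *)

Section Corner.
Variables (k : fieldType) (T : triple k) (n : nat).
Variable M : bimodType (tA T) (tA T).
Local Notation A := (tA T).
Local Notation B := (tB T).
Local Notation T' := (mat_triple T n).
Local Notation M' := (matmod M n.+1).

Definition corner (V : nmodType) (x : V) : 'M[V]_n.+1 :=
  \matrix_(i, j) if (i == 0) && (j == 0) then x else 0.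

Definition cornerA (a : A) : matalg A n.+1 := corner a.
Definition cornerM (m : M) : M' := corner m.

Fact cornerA_linear : linear cornerA.
Proof.
move=> c x y; apply/matrixP => i j; rewrite !mxE.
by case: ifP => // _; rewrite scaler0 addr0.
Qed.
HB.instance Definition _ :=
  GRing.isLinear.Build k A (matalg A n.+1) _ cornerA cornerA_linear.

Fact cornerM_linear : linear cornerM.
Proof.
move=> c x y; apply/matrixP => i j; rewrite !mxE.
by case: ifP => // _; rewrite scaler0 addr0.
Qed.
HB.instance Definition _ :=
  GRing.isLinear.Build k M M' _ cornerM cornerM_linear.

Definition entryA (X : matalg A n.+1) : A := (X : 'M_n.+1) 0 0.
Definition entryM (X : M') : M := (X : 'M_n.+1) 0 0.

Fact entryA_linear : linear entryA.
Proof. by move=> c x y; rewrite /entryA !mxE. Qed.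
HB.instance Definition _ :=
  GRing.isLinear.Build k (matalg A n.+1) A _ entryA entryA_linear.

Fact entryM_linear : linear entryM.
Proof. by move=> c x y; rewrite /entryM !mxE. Qed.
HB.instance Definition _ :=
  GRing.isLinear.Build k M' M _ entryM entryM_linear.

Fact scalmx_of_subproof (b : B) : (b%:M : matalg B n.+1) \in @scalar_pred k B n.
Proof. by apply/scalar_predP; exists b. Qed.
(** This serves both as [eta] in the Morita equivalence and as the B-component of the corner
    inclusion. *)
Definition scalmx_of (b : B) : scalmx B n := ScalarMx (scalmx_of_subproof b).

Fact scalmx_of_linear : linear scalmx_of.
Proof.
move=> c x y; apply: val_inj; apply/matrixP => i j.
by rewrite !mxE /= mulrnDl scalerMnr.
Qed.
HB.instance Definition _ :=
  GRing.isLinear.Build k B (scalmx B n) _ scalmx_of scalmx_of_linear.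
Fact scalmx_of_monoid_morphism : monoid_morphism scalmx_of.
Proof.
split; first exact: val_inj.
move=> x y; apply: val_inj; rewrite rmorphM /=; exact: scalar_mxM.
Qed.
HB.instance Definition _ :=
  GRing.isMonoidMorphism.Build B (scalmx B n) scalmx_of
    scalmx_of_monoid_morphism.

Fact scalmx_entry_linear : linear (@scalmx_entry k B n).
Proof. by move=> c x y; rewrite /scalmx_entry !mxE. Qed.
HB.instance Definition _ := GRing.isLinear.Build k (scalmx B n) B _
  (@scalmx_entry k B n) scalmx_entry_linear.

Lemma scalmx_ofK : cancel scalmx_of (@scalmx_entry k B n).
Proof. by move=> b; rewrite /scalmx_entry /= mxE eqxx. Qed.
Lemma scalmx_entryK : cancel (@scalmx_entry k B n) scalmx_of.
Proof. by move=> X; apply: val_inj; rewrite /= [RHS]scalmxE. Qed.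

End Corner.

(** * The corner inclusion is a homology isomorphism *)

Section MatrixHomology.
Variables (k : fieldType) (T : triple k) (n : nat).
Variable M : bimodType (tA T) (tA T).
Local Notation A := (tA T).
Local Notation B := (tB T).
Local Notation T' := (mat_triple T n).
Local Notation M' := (matmod M n.+1).
Local Notation R := (matalg A n.+1).

Lemma cornerAM a b : cornerA n (a * b) = cornerA n a * cornerA n b :> R.
Proof.
apply/matrixP => i j; rewrite !mxE big_ord_recl big1 => [|l _].
  by rewrite !mxE addr0; do 2?case: eqP => _ //=; rewrite ?(mul0r, mulr0).
by rewrite !mxE andbF mul0r.
Qed.

Lemma cornerA_eps a b :
  cornerA n (a * teps T b) = cornerA n a * teps T' (scalmx_of n b) :> R.
Proof.
apply/matrixP => i j; rewrite !mxE big_ord_recl big1 => [|l _].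
  rewrite !mxE addr0 scalmx_ofK eqxx andbT [ord0 == j]eq_sym.
  by do 2?case: eqP => _ //=; rewrite ?(mul0r, mulr0, mulr0n).
by rewrite !mxE andbF mul0r.
Qed.

Lemma cornerM_lact a (m : M) :
  cornerM n (lact a m) = lact (cornerA n a) (cornerM n m) :> M'.
Proof.
apply/matrixP => i j; rewrite !mxE big_ord_recl big1 => [|l _].
  rewrite !mxE addr0; do 2?case: eqP => _ //=;
  by rewrite ?(linear_fun0 (lact_linear _)) ?(linear_fun0 (lact_linearl _)).
by rewrite !mxE andbF (linear_fun0 (lact_linearl _)).
Qed.

Lemma cornerM_ract (m : M) a :
  cornerM n (ract m a) = ract (cornerM n m) (cornerA n a) :> M'.
Proof.
apply/matrixP => i j; rewrite !mxE big_ord_recl big1 => [|l _].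
  rewrite !mxE addr0; do 2?case: eqP => _ //=;
  by rewrite ?(linear_fun0 (ract_linear _)) ?(linear_fun0 (ract_linearr _)).
by rewrite !mxE andbF (linear_fun0 (ract_linear _)).
Qed.

Definition unit_col (q : 'I_n.+1) : R := delta_mx q 0.
Definition unit_row (q : 'I_n.+1) : R := delta_mx 0 q.
Local Notation e := (unit_row 0).

Lemma sum_unit_col_row : \sum_q unit_col q * unit_row q = 1.
Proof.
rewrite [RHS]mx1_sum_delta; apply: eq_bigr => q _.
by rewrite -[LHS]/(_ *m _) mul_delta_mx.
Qed.

Lemma mul_unit_row0 (X : R) : e * X * e = cornerA n (entryA X).
Proof.
apply/matrixP => i j.
rewrite !mxE (bigD1 0) //= big1 => [|l /negPf l0]; last first.
  by rewrite !mxE l0 mulr0.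
rewrite !mxE (bigD1 0) //= big1 => [|l /negPf l0]; last first.
  by rewrite !mxE l0 andbF mul0r.
rewrite !mxE !addr0 eqxx andbT.
by do 2?case: eqP => _ /=; rewrite ?(mul1r, mul0r, mulr0, mulr1).
Qed.

Lemma act_unit_row0 (Y : M') : lact e (ract Y e) = cornerM n (entryM Y).
Proof.
apply/matrixP => i j.
rewrite !mxE (bigD1 0) //= big1 => [|l /negPf l0]; last first.
  by rewrite mxE l0 andbF (linear_fun0 (lact_linearl _)).
rewrite !mxE (bigD1 0) //= big1 => [|l /negPf l0]; last first.
  by rewrite !mxE l0 (linear_fun0 (ract_linearr _)).
rewrite !mxE !addr0 eqxx andbT.
by do 2?case: eqP => _ /=; rewrite ?(ract1, lact1)
  ?(linear_fun0 (ract_linearr _)) ?(linear_fun0 (lact_linear _)) ?(linear_fun0 (lact_linearl _)).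
Qed.

Definition chain_corner i : chain M i -> chain (T := T') M' i :=
  @smap k T T' M M' (cornerM n (M := M)) (fun=> cornerA n (T := T))
    (scalmx_of n (T := T)) i.
HB.instance Definition _ i := GRing.Linear.on (@chain_corner i).

(** The (1,1) entry is not multiplicative in general, so this becomes a chain map only after
    composition with phi. *)
Definition chain_entry i : chain (T := T') M' i -> chain M i :=
  @smap k T' T M' M (@entryM k T n M) (fun=> @entryA k T n)
    (@scalmx_entry k B n) i.
HB.instance Definition _ i := GRing.Linear.on (@chain_entry i).

Local Notation gapmul' := (@gapmul k T' M' _).
Local Notation taus' := (@taus k T' M' _ unit_col unit_row).

Lemma chain_cornerK i : cancel (@chain_corner i) (@chain_entry i).
Proof.
move=> x; have E m a b :
    chain_entry (chain_corner (elt i m a b)) = elt i m a b :> chain M i.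
  rewrite /chain_corner /chain_entry !smap_elt; apply: eq_elt => [|q _|p q _ _].
  - by rewrite /= /entryM mxE.
  - by rewrite /= /entryA mxE.
  - exact: scalmx_ofK.
exact: (chain_eq (f := @chain_entry i \o @chain_corner i)
  (g := @idfun (chain M i))) x.
Qed.

(** Projection to the corner is multiplication by e at every gap, which makes [gapmul_taus]
    applicable. *)
Lemma chain_entryK i (x : chain (T := T') M' i) :
  chain_corner (chain_entry x) = gapmul' (fun=> e) (fun=> e) x.
Proof.
have E m a b : chain_corner (chain_entry (elt i m a b)) =
    gapmul' (fun=> e) (fun=> e) (elt i m a b).
  rewrite gapmul_elt /chain_corner /chain_entry !smap_elt.
  apply: eq_elt => [|q _|p q _ _].
  - exact/esym/act_unit_row0.
  - exact/esym/mul_unit_row0.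
  - exact: scalmx_entryK.
exact: (@chain_eq k T' M' i _ (@chain_corner i \o @chain_entry i)
  (gapmul' (fun=> e) (fun=> e)) E x).
Qed.

Lemma unit_row00 : e * e = e.
Proof. by rewrite -[LHS]/(_ *m _) mul_delta_mx. Qed.

Lemma mul_unit_row q : e * unit_row q = unit_row q.
Proof. by rewrite -[LHS]/(_ *m _) mul_delta_mx. Qed.

Lemma unit_col_mul q : unit_col q * e = unit_col q.
Proof. by rewrite -[LHS]/(_ *m _) mul_delta_mx. Qed.

Lemma mul_unit_col q : e * unit_col q = if q == 0 then e else 0.
Proof.
rewrite -[LHS]/(_ *m _); case: eqP => [->|/eqP q0].
  by rewrite mul_delta_mx.
by rewrite mul_delta_mx_0 // eq_sym.
Qed.

Lemma taus_chain_corner i r (x : chain M i) : (r <= i.+1)%N ->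
  taus' r (chain_corner x) = chain_corner x.
Proof.
elim: r => //= r IH ri; rewrite IH 1?ltnW // /tau.
(* A corner chain already carries e in all its gaps; as e u_q = 0 for q other than 0, only the
   summand q = 0 survives, and it multiplies by e again. *)
have -> : chain_corner x = gapmul' (fun=> e) (fun=> e) (chain_corner x).
  exact: etrans (congr1 _ (esym (chain_cornerK x))) (chain_entryK _).
rewrite (bigD1 0) //= big1 => [|q q0].
  rewrite addr0 gapmul_comp; apply: eq_gapmul => p _; rewrite /at_gap;
  by case: eqP; rewrite ?unit_row00 ?mulr1 ?mul1r.
rewrite gapmul_comp (@gapmul0 _ _ _ _ r) // /at_gap eqxx mul_unit_col.
by rewrite (negPf q0).
Qed.

Lemma chain_entry_tausK i (x : chain (T := T') M' i) :
  chain_corner (chain_entry (taus' i.+1 x)) = taus' i.+1 x.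
Proof.
rewrite chain_entryK.
rewrite -[RHS](@gapmul_taus k T' M' _ _ _ _ e x i.+1 unit_row00 unit_col_mul
  mul_unit_row).
by apply: eq_gapmul => p; rewrite -ltnS => ->.
Qed.

Lemma differential_corner i (x : chain M i) :
  differential (chain_corner x) = chain_corner (differential x).
Proof.
apply: differential_smap.
- exact: cornerAM.
- exact: cornerA_eps.
- exact: cornerM_lact.
- exact: cornerM_ract.
Qed.

(** This is the generalized trace: X_0, .., X_i goes to the sum over q_0, .., q_i of the tensors
    with entries (X_p)_(q_(p-1), q_p), where q_(-1) = q_i. *)
Definition chain_trace i : chain (T := T') M' i -> chain M i :=
  @chain_entry i \o @taus k T' M' _ unit_col unit_row i i.+1.
HB.instance Definition _ i := GRing.Linear.on (@chain_trace i).

Arguments chain_trace : simpl never.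

Lemma chain_corner_trace i (x : chain (T := T') M' i) :
  chain_corner (chain_trace x) = taus' i.+1 x.
Proof. exact: chain_entry_tausK. Qed.

Lemma differential_trace i (x : chain (T := T') M' i.+1) :
  differential (chain_trace x) = chain_trace (differential x).
Proof.
(* The corner inclusion is an injective chain map and turns the trace into phi, which commutes with
   the differential. *)
apply: (can_inj (@chain_cornerK _)).
rewrite -differential_corner !chain_corner_trace.
exact: (@differential_taus k T' M' _ unit_col unit_row sum_unit_col_row i x).
Qed.

Lemma chain_cornerK_trace i : cancel (@chain_corner i) (@chain_trace i).
Proof.
move=> x; apply: etrans (chain_cornerK x).
exact: (congr1 (@chain_entry i) (taus_chain_corner x (leqnn _))).
Qed.

Lemma sec_homology_matrix_iso i :
  lmod_iso (sec_homology M i) (sec_homology (T := T') M' i).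
Proof.
apply: (homology_iso (f := @chain_corner i) (g := @chain_trace i))
  => [v v0|u|v|u|v|v v0].
- by rewrite [LHS]differential_corner [differential v]v0 linear0.
- exists (chain_corner u); exact: (differential_corner u).
- case: i v => [|i] v v0 //.
  by rewrite [LHS]differential_trace [differential v]v0 linear0.
- exists (chain_trace u); exact: (differential_trace u).
- exact: chain_cornerK_trace.
- exists (@homotopy k T' M' _ unit_col unit_row i v).
  rewrite [LHS](@differential_homotopy k T' M' _ _ _ sum_unit_col_row i v v0).
  congr (_ - _); exact/esym/chain_corner_trace.
Qed.

End MatrixHomology.

(** * Rows and columns as bimodules *)

Section RowsAndColumns.
Variables (k : fieldType) (A : algType k).

(* An alias carrying the k-module structure, the library structure of
   'M[A]_(m, n) being that of an A-module. *)
Definition rectmx (m n : nat) : Type := 'M[A]_(m, n).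

Section KModule.
Variables m n : nat.
HB.instance Definition _ := GRing.Zmodule.copy (rectmx m n) 'M[A]_(m, n).

Let mscale (c : k) (X : rectmx m n) : rectmx m n := map_mx ( *:%R c) X.

Fact rectmx_scaleA c d X : mscale c (mscale d X) = mscale (c * d) X.
Proof. by apply/matrixP => i j; rewrite !mxE scalerA. Qed.
Fact rectmx_scale1 : left_id 1 mscale.
Proof. by move=> X; apply/matrixP => i j; rewrite !mxE scale1r. Qed.
Fact rectmx_scaleDr : right_distributive mscale +%R.
Proof. by move=> c X Y; apply/matrixP => i j; rewrite !mxE scalerDr. Qed.
Fact rectmx_scaleDl X : {morph mscale^~ X : a b / a + b}.
Proof. by move=> c d; apply/matrixP => i j; rewrite !mxE scalerDl. Qed.

HB.instance Definition _ := GRing.Zmodule_isLmodule.Build k (rectmx m n)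
  rectmx_scaleA rectmx_scale1 rectmx_scaleDr rectmx_scaleDl.
End KModule.

Definition rmul m n p (X : rectmx m n) (Y : rectmx n p) : rectmx m p := X *m Y.

Lemma rmul_linearr m n p (X : rectmx m n) : linear (@rmul m n p X).
Proof.
move=> c Y Z; rewrite /rmul [LHS]mulmxDr; congr (_ + _).
apply/matrixP => i j; rewrite !mxE scaler_sumr; apply: eq_bigr => l _.
by rewrite mxE scalerAr.
Qed.

Lemma rmul_linearl m n p (Y : rectmx n p) :
  linear (fun X : rectmx m n => rmul X Y).
Proof.
move=> c X Z; rewrite /rmul [LHS]mulmxDl; congr (_ + _).
apply/matrixP => i j; rewrite !mxE scaler_sumr; apply: eq_bigr => l _.
by rewrite mxE scalerAl.
Qed.

(** Viewing A as 1 x 1 matrices turns its actions into matrix products, so the compatibility axioms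
    reduce to associativity. *)
Definition to11 (a : A) : rectmx 1 1 := a%:M.

Lemma to11_linear : linear to11.
Proof.
by move=> c a b; apply/matrixP => i j; rewrite !mxE mulrnDl scalerMnr.
Qed.

Definition of11 (X : rectmx 1 1) : A := (X : 'M_1) 0 0.

Lemma of11_linear : linear of11.
Proof. by move=> c X Y; rewrite /of11 !mxE. Qed.

Lemma to11K : cancel to11 of11.
Proof. by move=> a; rewrite /of11 mxE eqxx. Qed.
Lemma of11K : cancel of11 to11.
Proof. by move=> X; apply/esym/mx11_scalar. Qed.
Lemma to11M a b : to11 (a * b) = rmul (to11 a) (to11 b).
Proof. exact: scalar_mxM. Qed.
Lemma rmulA m n p q (X : rectmx m n) (Y : rectmx n p) (Z : rectmx p q) :
  rmul X (rmul Y Z) = rmul (rmul X Y) Z.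
Proof. exact: mulmxA. Qed.

Variable n : nat.

Definition rowmod : Type := rectmx 1 n.+1.
Definition colmod : Type := rectmx n.+1 1.
HB.instance Definition _ := GRing.Lmodule.on rowmod.
HB.instance Definition _ := GRing.Lmodule.on colmod.

Let row_lact (a : A) (p : rowmod) : rowmod := rmul (to11 a) p.
Let row_ract (p : rowmod) (X : matalg A n.+1) : rowmod := rmul p X.
Let col_lact (X : matalg A n.+1) (q : colmod) : colmod := rmul X q.
Let col_ract (q : colmod) (a : A) : colmod := rmul q (to11 a).

Fact row_lact_linear a : linear (row_lact a).
Proof. exact: rmul_linearr. Qed.
Fact row_lact_linearl p : linear (row_lact^~ p).
Proof. by move=> c a b; rewrite /row_lact to11_linear; apply: rmul_linearl. Qed.
Fact row_lact1 p : row_lact 1 p = p.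
Proof. exact: mul1mx. Qed.
Fact row_lactA a b p : row_lact a (row_lact b p) = row_lact (a * b) p.
Proof. by rewrite /row_lact to11M rmulA. Qed.
Fact row_ract_linear X : linear (row_ract^~ X).
Proof. exact: rmul_linearl. Qed.
Fact row_ract_linearr p : linear (row_ract p).
Proof. exact: rmul_linearr. Qed.
Fact row_ract1 p : row_ract p 1 = p.
Proof. exact: mulmx1. Qed.
Fact row_ractA p X Y : row_ract (row_ract p X) Y = row_ract p (X * Y).
Proof. exact/esym/mulmxA. Qed.
Fact row_lractA a p X : row_ract (row_lact a p) X = row_lact a (row_ract p X).
Proof. exact/esym/mulmxA. Qed.

HB.instance Definition _ := isBimodule.Build k A (matalg A n.+1) rowmod
  row_lact_linear row_lact_linearl row_lact1 row_lactA
  row_ract_linear row_ract_linearr row_ract1 row_ractA row_lractA.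

Fact col_lact_linear X : linear (col_lact X).
Proof. exact: rmul_linearr. Qed.
Fact col_lact_linearl q : linear (col_lact^~ q).
Proof. exact: rmul_linearl. Qed.
Fact col_lact1 q : col_lact 1 q = q.
Proof. exact: mul1mx. Qed.
Fact col_lactA X Y q : col_lact X (col_lact Y q) = col_lact (X * Y) q.
Proof. exact: mulmxA. Qed.
Fact col_ract_linear a : linear (col_ract^~ a).
Proof. exact: rmul_linearl. Qed.
Fact col_ract_linearr q : linear (col_ract q).
Proof. by move=> c a b; rewrite /col_ract to11_linear; apply: rmul_linearr. Qed.
Fact col_ract1 q : col_ract q 1 = q.
Proof. exact: mulmx1. Qed.
Fact col_ractA q a b : col_ract (col_ract q a) b = col_ract q (a * b).
Proof. by rewrite /col_ract to11M rmulA. Qed.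
Fact col_lractA X q a : col_ract (col_lact X q) a = col_lact X (col_ract q a).
Proof. exact/esym/mulmxA. Qed.

HB.instance Definition _ := isBimodule.Build k (matalg A n.+1) A colmod
  col_lact_linear col_lact_linearl col_lact1 col_lactA
  col_ract_linear col_ract_linearr col_ract1 col_ractA col_lractA.

End RowsAndColumns.

(** Pure tensors span, so a pairing that is A-linear on both sides induces a bimodule map; its
    inverse g need only be k-linear. *)
Lemma btensor_iso_regular (k : fieldType) (A A' : algType k)
    (P : bimodType A A') (Q : bimodType A' A)
    (f : P * Q -> regular A) (fB : balanced f) (g : A -> btensor P Q) :
  (forall a p q, f (lact a p, q) = a * f (p, q)) ->
  (forall a p q, f (p, ract q a) = f (p, q) * a) ->
  linear g ->
  (forall p q, g (f (p, q)) = btens p q) ->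
  (forall a, blift fB (g a) = a) ->
  bimod_iso (btensor P Q) (regular A).
Proof.
move=> fl fr lg gf fg; exists (blift fB); split.
- exists g => // x; elim/btensor_ind: x => [|c p q y IH].
    by rewrite linear0 (linear_fun0 lg).
  by rewrite linearP lg IH /= blift_btens gf.
- move=> a x; elim/btensor_ind: x => [|c p q y IH].
    by rewrite !linear0 !(linear_fun0 (lact_linear _)) linear0.
  rewrite lact_linear !linearP /= IH lact_linear; congr (_ *: _ + _).
  by rewrite [lact a _]btensor_lactE !blift_btens fl.
- move=> x a; elim/btensor_ind: x => [|c p q y IH].
    by rewrite !linear0 !(linear_fun0 (ract_linear _)) linear0.
  rewrite ract_linear !linearP /= IH ract_linear; congr (_ *: _ + _).
  by rewrite [ract _ a]btensor_ractE !blift_btens fr.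
Qed.

(** * The Morita equivalence of triples *)

Section MatrixMorita.
Variables (k : fieldType) (T : triple k) (n : nat).
Local Notation A := (tA T).
Local Notation R := (matalg A n.+1).
Local Notation P := (rowmod A n).
Local Notation Q := (colmod A n).

Let row_delta j : rectmx A 1 n.+1 := delta_mx 0 j.
Let col_delta j : rectmx A n.+1 1 := delta_mx j 0.

Lemma row_col_delta j : rmul (row_delta j) (col_delta j) = to11 1.
Proof.
by rewrite /rmul mul_delta_mx; apply/matrixP => a b; rewrite !ord1 !mxE.
Qed.

Lemma sum_col_row_delta :
  \sum_j rmul (col_delta j) (row_delta j) = 1%:M :> rectmx A n.+1 n.+1.
Proof.
rewrite [RHS]mx1_sum_delta; apply: eq_bigr => j _.
by rewrite /rmul mul_delta_mx.
Qed.

Lemma row_col_balanced :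
  balanced (fun pq : P * Q => of11 (rmul pq.1 pq.2) : regular A).
Proof.
split=> [q c p p'|p c q q'|p X q] /=.
- by rewrite rmul_linearl; apply: of11_linear.
- by rewrite rmul_linearr; apply: of11_linear.
- by congr of11; apply/esym/mulmxA.
Qed.

Lemma row_col_iso : bimod_iso (btensor P Q) (regular A).
Proof.
have [bl br ba] := btens_balanced P Q.
(* The inverse sends a to (a times the first unit row) tensor the first unit column. *)
apply: (btensor_iso_regular (fB := row_col_balanced)
  (g := fun a => btens (rmul (to11 a) (row_delta 0) : P) (col_delta 0 : Q))).
- move=> a p q; apply: (can_inj (@to11K _ A)).
  rewrite to11M !of11K; exact/esym/mulmxA.
- move=> a p q; apply: (can_inj (@to11K _ A)).
  rewrite to11M !of11K; exact/mulmxA.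
- by move=> c a b; rewrite to11_linear rmul_linearl; apply: bl.
- move=> p q; rewrite of11K -rmulA.
  (* q times the unit row is a square matrix; balancedness moves it across, where the unit row meets
     the unit column and gives 1. *)
  transitivity (btens (ract p (rmul q (row_delta 0) : R)) (col_delta 0 : Q)).
    by [].
  rewrite [LHS]ba; congr btens.
  rewrite /= -[LHS]/(rmul _ _) -rmulA row_col_delta.
  exact: mulmx1.
- move=> a; rewrite blift_btens /= -rmulA row_col_delta.
  by rewrite [rmul _ _]mulmx1 to11K.
Qed.

Lemma col_row_balanced :
  balanced (fun qp : Q * P => rmul qp.1 qp.2 : regular R).
Proof.
split=> [p c q q'|q c p p'|q a p] /=.
- exact: rmul_linearl.
- exact: rmul_linearr.
- exact/esym/mulmxA.
Qed.

Lemma col_row_iso : bimod_iso (btensor Q P) (regular R).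
Proof.
have [bl br ba] := btens_balanced Q P.
(* The inverse splits X into its columns, each paired with the matching unit row. In the check, p
   times a unit column is a scalar and crosses the tensor sign. *)
apply: (btensor_iso_regular (fB := col_row_balanced)
  (g := fun X => \sum_j btens (rmul X (col_delta j) : Q) (row_delta j : P))).
- by move=> X q p; exact/esym/mulmxA.
- by move=> X q p; exact/mulmxA.
- move=> c X Y; rewrite scaler_sumr -big_split; apply: eq_bigr => j _ /=.
  rewrite rmul_linearl; exact: bl.
- move=> q p; transitivity (btens q
    (\sum_j rmul (rmul p (col_delta j)) (row_delta j) : P)).
    rewrite (linear_fun_sum (br q)); apply: eq_bigr => j _.
    rewrite -rmulA -[rmul p _]of11K; exact: ba.
  congr btens; under eq_bigr do rewrite -rmulA.
  rewrite -(linear_fun_sum (rmul_linearr p)) sum_col_row_delta; exact: mulmx1.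
- move=> X; rewrite linear_sum.
  under eq_bigr do rewrite /= blift_btens /= -rmulA.
  rewrite -(linear_fun_sum (rmul_linearr X)) sum_col_row_delta; exact: mulmx1.
Qed.

Lemma scalar_rmul (m : nat) (a : A) (X : rectmx A m 1) (Y : rectmx A 1 m) :
  (forall b, a * b = b * a) ->
  rmul (to11 a) Y = rmul Y (a%:M : rectmx A m m) /\
  rmul X (to11 a) = rmul (a%:M : rectmx A m m) X.
Proof.
move=> aC; split; rewrite /rmul /to11 -!diag_const_mx;
  by apply/matrixP => i j; rewrite mul_diag_mx mul_mx_diag !mxE aC.
Qed.

Lemma matrix_morita : morita_equiv T (mat_triple T n).
Proof.
exists P, Q, (scalmx_of n (T := T)); split.
- exact: row_col_iso.
- exact: col_row_iso.
- exists (@scalmx_entry k (tB T) n).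
    exact: scalmx_ofK.
  exact: scalmx_entryK.
(* Condition (iii) is centrality of [eps b]; the 0 is a placeholder for the column argument. *)
- move=> b p; have [E _] := scalar_rmul (m := n.+1) 0 p (teps_central b).
  rewrite [LHS]E /=; congr (rmul p _); rewrite /= /mat_eps scalmx_ofK //.
- move=> b q; have [_ E] := scalar_rmul (m := n.+1) q 0 (teps_central b).
  rewrite [LHS]E /=; congr (rmul _ q); rewrite /= /mat_eps scalmx_ofK //.
Qed.

End MatrixMorita.

Theorem proposition2p8 (k : fieldType) (T : triple k) (n : nat)
    (M : bimodType (tA T) (tA T)) (hM : Bsymmetric M) :
  morita_equiv T (mat_triple T n) /\
  (forall i : nat,
     lmod_iso (sec_homology M i)
              (sec_homology (T := mat_triple T n) (matmod M n.+1) i)).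
Proof.
split; first exact: matrix_morita.
exact: sec_homology_matrix_iso.
Qed.
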